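(* Let $G$ be a profinite group. The functor $\Delta_G$ is equivalent (i.e. naturally isomorphic) to the functor $W_G$, as functors from the category of commutative rings with identity to itself.
   Context: Conventions. All rings are commutative, associative, with $1\neq 0$. $G$ is a profinite group; $U,V,W$ denote open subgroups; $\mathcal O(G)$ is the set of open subgroups of $G$. $U\lesssim V$ means that $U$ is contained in a $G$-conjugate of $V$, and then $(V:U)$ denotes the index of $U$ in such a conjugate. $\varphi_U(G/V)$ is the number of $U$-fixed points of the $G$-space of left cosets $G/V$. A prime on $\sum$ or $\prod$ means that exactly one open subgroup from each $G$-conjugacy class is taken; elements of $\prod'_{U\leqslant G}R$ are written $(x_U)'_{U}$. $R^{\underline{\mathcal O(G)}}$ is the ring of maps $\mathcal O(G)\to R$ constant on conjugacy classes, with pointwise operations. The same notation is used for an open subgroup $U$ of $G$ regarded as a profinite group (with $U$-conjugacy classes). The functor $W_G$ (Dress-Siebeneicher). $W_G$ is the unique functor from commutative rings to commutative rings such that: as a set $W_G(A)=A^{\underline{\mathcal O(G)}}$; $W_G(h)(\alpha)=h\circ\alpha$ for every ring homomorphism $h:A\to B$; and for every open $U$ the map $\phi_U^A:W_G(A)\to A$, $\alpha\mapsto\sum'_{U\lesssim V\leqslant G}\varphi_U(G/V)\,\alpha(V)^{(V:U)}$, is a ring homomorphism, natural in $A$. For an ideal $I$ of $A$, $W_G(I)$ denotes the set of $\alpha\in W_G(A)$ with all values in $I$. The functor $\Delta_G$ on objects, together with maps $\tau_R^G:W_G(R)\to\Delta_G(R)$. Case 1: $R\supseteq\mathbb Q$.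 $\Delta_G(R)$ is the set $\prod'_{U\leqslant G}R$ with componentwise addition and multiplication $(\mathbf x\mathbf y)_U=\sum'_{V,W}p_V^W(U)x_Vy_W$, where $p_V^W(U)$ is the number of double cosets $VgW\subseteq G$ such that $V\cap gWg^{-1}$ is conjugate to $U$ in $G$. For $r\in R$ let $(M_G(r,U))'_U$ be the unique family in $R$ with $\sum'_{U\lesssim V\leqslant G}\varphi_U(G/V)M_G(r,V)=r^{(G:U)}$ for all open $U$, and put $\tau^G(R):R\to\Delta_G(R)$, $r\mapsto(M_G(r,U))'_U$ (and likewise $\tau^U(R):R\to\Delta_U(R)$ for the group $U$). For $U\leqslant G$ open, $\mathrm{Ind}_U^G(R):\Delta_U(R)\to\Delta_G(R)$ sends $(x_V)'_{V\leqslant U}$ to $(y_W)'_{W\leqslant G}$, where $y_W$ is the sum of those $x_V$ (one $V$ per $U$-conjugacy class) with $V$ conjugate to $W$ in $G$. Then $\tau_R^G(\alpha)=\sum'_{U\leqslant G}\mathrm{Ind}_U^G(R)(\tau^U(R)(\alpha(U)))$ (a sum finite in each component). Case 2: $R$ is torsion-free and does not contain $\mathbb Q$. Put $R\mathbb Q=R\otimes_{\mathbb Z}\mathbb Q$, regard $W_G(R)\subset W_G(R\mathbb Q)$, and let $\Delta_G(R):=\tau^G_{R\mathbb Q}(W_G(R))\subset\Delta_G(R\mathbb Q)$ with the operations of $\Delta_G(R\mathbb Q)$; $\tau_R^G$ is the restriction of $\tau^G_{R\mathbb Q}$. Case 3: $R$ is not torsion-free. Choose a surjective ring homomorphism $\rho:R'\to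 R$ with $R'$ torsion-free (e.g. $R'=\mathbb Z[R]$, the ring with $\mathbb Z$-basis $e_r$, $r\in R$, $e_re_s=e_{rs}$, and $\rho(\sum n_re_r)=\sum n_r r$). Put $\Delta_G(\ker\rho):=\tau_{R'}^G(W_G(\ker\rho))$ and $\Delta_G(R):=\Delta_G(R')/\Delta_G(\ker\rho)$; $\tau_R^G$ is the map induced by $\tau_{R'}^G$ on $W_G(R)=W_G(R')/W_G(\ker\rho)$. (The result is independent of the choice of $(R',\rho)$ up to isomorphism.) Morphisms. For a ring homomorphism $f:A\to B$, $\Delta_G(f):\Delta_G(A)\to\Delta_G(B)$ is given by $\tau_A^G(\mathbf x)\mapsto\tau_B^G(W_G(f)(\mathbf x))$ for $\mathbf x\in W_G(A)$. *)

(* Defs.v *)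
From HB Require Import structures.
From mathcomp Require Import all_boot all_order all_algebra.
From mathcomp Require Import finmap.
From mathcomp Require Import all_classical all_reals all_analysis.
Import GRing.Theory.

Set Implicit Arguments.
Unset Strict Implicit.
Unset Printing Implicit Defensive.

Local Open Scope classical_set_scope.
Local Open Scope ring_scope.

HB.mixin Record isProfiniteGroup G of Topological G & Group G := {
  mulg_continuous : continuous (fun xy : G * G => (xy.1 * xy.2)%g);
  invg_continuous : continuous (fun x : G => x^-1%g);
  profinite_compact : compact [set: G];
  profinite_hausdorff : hausdorff_space G;
  profinite_totally_disconnected : totally_disconnected [set: G]
}.

#[short(type="profiniteGroupType")]
HB.structure Definition ProfiniteGroup :=
  {G of Topological G & Group G & isProfiniteGroup G}.

Section OpenSubgroups.
Variable G : profiniteGroupType.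

Record open_subgroup := OpenSubgroup {
  osg_set :> set G;
  osg_open : open osg_set;
  osg1 : osg_set 1%g;
  osgM : forall x y, osg_set x -> osg_set y -> osg_set (x * y)%g;
  osgV : forall x, osg_set x -> osg_set x^-1%g
}.

HB.instance Definition _ := gen_eqMixin open_subgroup.
HB.instance Definition _ := gen_choiceMixin open_subgroup.

Definition conj_set (g : G) (A : set G) : set G :=
  [set (g * a * g^-1)%g | a in A].

Definition left_coset (g : G) (A : set G) : set G := [set (g * a)%g | a in A].

Definition double_coset (A : set G) (g : G) (B : set G) : set G :=
  [set x | exists a b, [/\ A a, B b & x = (a * g * b)%g]].

(* The notions below are relative to a subgroup [H] of [G]. The open subgroups
   of an open subgroup [H], seen as a profinite group, are exactly the open
   subgroups of [G] contained in [H]; the case of [G] is [H := [set: G]]. *)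

Definition conjugate_in (H A B : set G) : Prop :=
  exists2 h, H h & B = conj_set h A.

Definition subconjugate_in (H A B : set G) : Prop :=
  exists2 h, H h & A `<=` conj_set h B.

Definition class_rep (H : set G) (V : open_subgroup) : open_subgroup :=
  xget V [set V' : open_subgroup | conjugate_in H V V'].

(* Contains exactly one open subgroup from each [H]-conjugacy class of open
   subgroups of [H]: the index set of the primed sums and products over [H]. *)
Definition class_transversal (H : set G) : set open_subgroup :=
  [set V : open_subgroup | V `<=` H /\ class_rep H V = V].

(* [fset_set A] is empty when [A] is infinite. *)
Definition ncard (T : choiceType) (A : set T) : nat := #|` fset_set A|.

Definition index_in (H U : set G) : nat :=
  ncard [set C : set G | exists2 h, H h & C = left_coset h U].

(* [(V : U)] for [U] contained in a [G]-conjugate of [V]. *)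
Definition gindex (V U : set G) : nat :=
  index_in (conj_set (xget 1%g [set g | U `<=` conj_set g V]) V) U.

(* [varphi_U (H / V)]. *)
Definition fixed_cosets (U H V : set G) : nat :=
  ncard [set C : set G | (exists2 h, H h & C = left_coset h V) /\
                         (forall u, U u -> left_coset u C = C)].

(* [p_V^W (U)]. *)
Definition pcoef (V W U : set G) : nat :=
  ncard [set D : set G | exists g,
    D = double_coset V g W /\ conjugate_in setT (V `&` conj_set g W) U].

(* The common underlying set of [W_G(R)] and of the product of copies of [R]
   over the conjugacy classes: a family indexed by conjugacy classes is the same
   thing as a map on open subgroups that is constant on conjugacy classes. *)
Record class_family (R : Type) := ClassFamily {
  cf_val :> open_subgroup -> R;
  cf_conj : forall U V : open_subgroup, conjugate_in setT U V -> cf_val U = cf_val V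
}.

Lemma conj_setM g h (A : set G) :
  conj_set g (conj_set h A) = conj_set (g * h)%g A.
Proof.
apply/seteqP; split=> x /=.
  by move=> [_ [a Aa <-] <-]; exists a; rewrite // invgM !mulgA.
by move=> [a Aa <-]; exists (h * a * h^-1)%g; [exists a|rewrite invgM !mulgA].
Qed.

Lemma conj_set1 (A : set G) : conj_set 1%g A = A.
Proof.
rewrite /conj_set (_ : (fun a => _) = id) ?image_id//.
by apply/funext => x; rewrite mul1g invg1 mulg1.
Qed.

Lemma conjugate_in_eq (A B C : set G) : conjugate_in setT B C ->
  conjugate_in setT A B = conjugate_in setT A C.
Proof.
move=> [g _ ->]; apply/propext; split=> -[h _ E].
  by exists (g * h)%g; rewrite // E conj_setM.
by exists (g^-1 * h)%g; rewrite // -conj_setM -E conj_setM mulVg conj_set1.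
Qed.

Lemma class_family_ext (R : Type) (x y : class_family R) : x =1 y -> x = y.
Proof.
case: x y => [x cx] [y cy] /= /funext xy; case: _ / xy cy => cy.
by congr ClassFamily; exact: Prop_irrelevance.
Qed.

Lemma cf_map_conj (A B : Type) (h : A -> B) (a : class_family A)
    (U V : open_subgroup) : conjugate_in setT U V -> h (a U) = h (a V).
Proof. by move=> UV; rewrite (cf_conj a UV). Qed.

Definition cf_map (A B : Type) (h : A -> B) (a : class_family A) :
  class_family B := ClassFamily (cf_map_conj h a).

End OpenSubgroups.

Arguments cf_map {G A B} h a.
Arguments class_transversal {G} H.

Section Ghost.
Variables (G : profiniteGroupType) (A : comNzRingType).

Definition ghost (U : open_subgroup G) (a : class_family G A) : A :=
  \sum_(V \in [set V | class_transversal setT V /\ subconjugate_in setT U V])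
    (fixed_cosets U setT V)%:R * a V ^+ gindex V U.

End Ghost.

Record ring_functor := RingFunctor {
  fobj :> comNzRingType -> comNzRingType;
  fmor : forall A B : comNzRingType,
    {rmorphism A -> B} -> {rmorphism fobj A -> fobj B};
  fmor_id : forall (A : comNzRingType) (x : fobj A), fmor idfun x = x;
  fmor_comp : forall (A B C : comNzRingType)
    (f : {rmorphism A -> B}) (g : {rmorphism B -> C}) (x : fobj A),
    fmor (g \o f) x = fmor g (fmor f x)
}.

Definition naturally_isomorphic (E F : ring_functor) : Prop :=
  exists eta : forall A : comNzRingType, {rmorphism E A -> F A},
    (forall A, bijective (eta A)) /\
    (forall (A B : comNzRingType) (f : {rmorphism A -> B}) (x : E A),
       eta B (fmor E f x) = fmor F f (eta A x)).

(* The defining property of the Dress-Siebeneicher functor [W_G]: ring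
   structures on the sets [class_family G A], functorial by composition, for
   which all the ghost maps are natural ring homomorphisms. *)
Record witt_burnside (G : profiniteGroupType) := WittBurnside {
  wb_class : forall A : comNzRingType,
    GRing.ComNzRing.axioms_ (class_family G A);
  wb_obj : comNzRingType -> comNzRingType := fun A =>
    GRing.ComNzRing.Pack (wb_class A);
  wb_map : forall A B : comNzRingType,
    {rmorphism A -> B} -> {rmorphism wb_obj A -> wb_obj B};
  wb_mapE : forall (A B : comNzRingType) (h : {rmorphism A -> B})
    (a : class_family G A), wb_map h a = cf_map h a;
  wb_ghost : forall (A : comNzRingType) (U : open_subgroup G),
    {rmorphism wb_obj A -> A};
  wb_ghostE : forall (A : comNzRingType) (U : open_subgroup G)
    (a : class_family G A), wb_ghost A U a = ghost U a;
  wb_ghost_natural : forall (A B : comNzRingType) (h : {rmorphism A -> B})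
    (U : open_subgroup G) (a : wb_obj A),
    h (wb_ghost A U a) = wb_ghost B U (wb_map h a)
}.

Section WittBurnsideFunctor.
Variables (G : profiniteGroupType) (W : witt_burnside G).

Lemma wb_map_id (A : comNzRingType) (x : wb_obj W A) : wb_map W idfun x = x.
Proof. by rewrite wb_mapE; apply: class_family_ext. Qed.

Lemma wb_map_comp (A B C : comNzRingType) (f : {rmorphism A -> B})
    (g : {rmorphism B -> C}) (x : wb_obj W A) :
  wb_map W (g \o f) x = wb_map W g (wb_map W f x).
Proof. by rewrite !wb_mapE; apply: class_family_ext. Qed.

Definition witt_burnside_functor : ring_functor :=
  RingFunctor wb_map_id wb_map_comp.

End WittBurnsideFunctor.

Coercion witt_burnside_functor : witt_burnside >-> ring_functor.

Definition contains_rat (R : comNzRingType) : Prop :=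
  inhabited {rmorphism rat -> R}.

Definition torsion_free (R : comNzRingType) : Prop :=
  forall (n : nat) (x : R), x *+ n.+1 = 0 -> x = 0.

(* [S], with the maps [j] and [i], is the tensor product of the rings [R] and
   [rat] over the integers, i.e. their coproduct in commutative rings. *)
Definition is_tensor_rat (R S : comNzRingType)
    (j : {rmorphism R -> S}) (i : {rmorphism rat -> S}) : Prop :=
  forall (T : comNzRingType) (f : {rmorphism R -> T}) (g : {rmorphism rat -> T}),
    exists h : {rmorphism S -> T},
      [/\ h \o j =1 f, h \o i =1 g &
          forall h' : {rmorphism S -> T},
            h' \o j =1 f -> h' \o i =1 g -> h' =1 h].

Section RationalCase.
Variables (G : profiniteGroupType) (R : comNzRingType).
Implicit Types (x y a : class_family G R) (r : R).

Definition delta_add_val x y (U : open_subgroup G) : R := x U + y U.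

Lemma delta_add_conj x y (U V : open_subgroup G) :
  conjugate_in setT U V -> delta_add_val x y U = delta_add_val x y V.
Proof. by move=> UV; rewrite /delta_add_val (cf_conj x UV) (cf_conj y UV). Qed.

Definition delta_add x y : class_family G R := ClassFamily (delta_add_conj x y).

Definition delta_mul_val x y (U : open_subgroup G) : R :=
  \sum_(VW \in class_transversal setT `*` class_transversal setT)
    (pcoef VW.1 VW.2 U)%:R * x VW.1 * y VW.2.

Lemma delta_mul_conj x y (U V : open_subgroup G) :
  conjugate_in setT U V -> delta_mul_val x y U = delta_mul_val x y V.
Proof.
move=> UV; rewrite /delta_mul_val.
apply: eq_fsbigr => AB _; congr (_%:R * _ * _); congr ncard.
by apply/seteqP; split=> C [g [-> E]]; exists g; move: E;
  rewrite (conjugate_in_eq _ UV).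
Qed.

Definition delta_mul x y : class_family G R := ClassFamily (delta_mul_conj x y).

(* The families on the open subgroups of [H] (extended by [0] to the open
   subgroups of [G] not contained in [H]) that solve the equations defining
   [(M_H (r, U))'_U]. *)
Definition is_necklace (H : set G) r (m : open_subgroup G -> R) : Prop :=
  [/\ forall U V : open_subgroup G,
        U `<=` H -> conjugate_in H U V -> m U = m V,
      forall U : open_subgroup G, ~ (U `<=` H) -> m U = 0 &
      forall U : open_subgroup G, U `<=` H ->
        \sum_(V \in [set V | class_transversal H V /\ subconjugate_in H U V])
          (fixed_cosets U H V)%:R * m V = r ^+ index_in H U].

(* [M_H (r, -)], i.e. [tau^H(R) (r)]: the unique solution if [R] contains the
   rationals, a junk value if there is no solution. *)
Definition necklace (H : set G) r : open_subgroup G -> R :=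
  xget (fun=> 0) [set m | is_necklace H r m].

(* [Ind_U^G]. *)
Definition ind_family (U : set G) (m : open_subgroup G -> R)
    (W : open_subgroup G) : R :=
  \sum_(V \in [set V | class_transversal U V /\ conjugate_in setT V W]) m V.

(* [tau_R^G] for [R] containing the rationals. *)
Definition tau_rat_val a (W : open_subgroup G) : R :=
  \sum_(U \in class_transversal setT) ind_family U (necklace U (a U)) W.

Lemma tau_rat_conj a (U V : open_subgroup G) :
  conjugate_in setT U V -> tau_rat_val a U = tau_rat_val a V.
Proof.
move=> UV; rewrite /tau_rat_val.
apply: eq_fsbigr => A _; rewrite /ind_family.
congr (\sum_(X \in _) _); apply/funext => X /=.
by rewrite (conjugate_in_eq _ UV).
Qed.

Definition tau_rat a : class_family G R := ClassFamily (tau_rat_conj a).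

End RationalCase.

Section Delta.
Variables (G : profiniteGroupType) (D : ring_functor).
Variable tau : forall R : comNzRingType, class_family G R -> D R.

Definition delta_rational (R : comNzRingType) : Prop :=
  exists e : D R -> class_family G R,
    [/\ bijective e,
        {morph e : x y / x + y >-> delta_add x y},
        {morph e : x y / x * y >-> delta_mul x y} &
        forall a, e (tau a) = tau_rat a].

Definition delta_torsion_free (R : comNzRingType) : Prop :=
  exists (RQ : comNzRingType) (j : {rmorphism R -> RQ})
         (i : {rmorphism rat -> RQ}) (e : D R -> class_family G RQ),
    [/\ is_tensor_rat j i,
        injective e /\
          range e = [set tau_rat (cf_map j a) | a in [set: class_family G R]],
        {morph e : x y / x + y >-> delta_add x y},
        {morph e : x y / x * y >-> delta_mul x y} &
        forall a, e (tau a) = tau_rat (cf_map j a)].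

(* [q] exhibits [D R] as the quotient of [D R'] by [Delta_G (ker rho)]. *)
Definition delta_quotient (R : comNzRingType) : Prop :=
  exists (R' : comNzRingType) (rho : {rmorphism R' -> R})
         (q : {rmorphism D R' -> D R}),
    [/\ torsion_free R',
        set_surj setT setT rho,
        set_surj setT setT q,
        q @^-1` [set 0] =
          [set tau a | a in [set a : class_family G R' |
                              forall U, rho (a U) = 0]] &
        forall a : class_family G R', tau (cf_map rho a) = q (tau a)].

(* [D], with the maps [tau], is the functor [Delta_G]. It is determined up to
   isomorphism only, since its definition involves choices of the rings
   [R (x) Q] and of the presentations [rho]. *)
Definition is_Delta : Prop :=
  [/\ forall R : comNzRingType, contains_rat R -> delta_rational R,
      forall R : comNzRingType, torsion_free R -> ~ contains_rat R ->
        delta_torsion_free R,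
      forall R : comNzRingType, ~ torsion_free R -> delta_quotient R &
      forall (A B : comNzRingType) (f : {rmorphism A -> B})
             (a : class_family G A),
        fmor D f (tau a) = tau (cf_map f a)].

End Delta.

(* Main.v *)
(* Counting fixed points gives maps [mark U : Delta_G(R) -> R], additive by
   construction and multiplicative because the orbits of [G/V x G/W] are the
   [G/(V `&` g W g^-1)]. Induction from [X] to [G] splits the [U]-fixed points of
   [G/Y] over those of [G/X], whence [mark U (tau a) = ghost U a]. Both systems
   are triangular in the index of [U], with diagonal entries the nonzero integers
   [fixed_cosets U G U]; so over a ring containing the rationals [tau] is a ring
   isomorphism from [W_G(R)]. A torsion-free ring embeds in its tensor product with
   the rationals, and any ring is a quotient of a polynomial ring over the
   integers, to which the statement descends because [W_G(ker rho)] is the kernel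
   of [W_G(rho)]. Hence [W_G] itself with [tau = id] is a model of [Delta_G], and
   for any other model [tau] is the required natural isomorphism. *)
Require Import Defs.
From HB Require Import structures.
From mathcomp Require Import all_boot all_order all_algebra.
From mathcomp Require Import generic_quotient ring zify finmap.
From mathcomp Require Import -(notations) monalg.
From mathcomp Require Import boolp classical_sets functions cardinality fsbigop.
From mathcomp Require Import topology.
Import GRing.Theory Num.Theory.

Set Implicit Arguments.
Unset Strict Implicit.
Unset Printing Implicit Defensive.

Local Open Scope classical_set_scope.
Local Open Scope quotient_scope.
Local Open Scope ring_scope.

(** * Cosets of open subgroups *)

(** After the two sums are exchanged, the inner one reduces for each [i] to the single index
    [f i]. *)
Lemma fsum_fiber (R : nmodType) (I J : choiceType) (P : set I) (Q : set J)
    (f : I -> J) (F : I -> R) :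
  finite_set P -> finite_set Q -> (forall i, P i -> Q (f i)) ->
  \sum_(i \in P) F i = \sum_(j \in Q) \sum_(i \in P `&` f @^-1` [set j]) F i.
Proof.
move=> Pfin Qfin PQ; under [RHS]eq_fsbigr do rewrite fsbig_mkcondr.
rewrite exchange_fsbig//; apply: eq_fsbigr => i; rewrite inE => Pi.
rewrite -(fsbig_widen [set f i]) ?fsbig_set1 ?mem_set//.
  by move=> _ ->; exact: PQ.
by move=> j [_ /= ji]; case: ifPn => // /set_mem/= /esym.
Qed.

Lemma natr_fsum (R : pzSemiRingType) (I : choiceType) (P : set I) (F : I -> nat) :
  finite_set P ->
  (\sum_(i \in P) F i)%:R = \sum_(i \in P) ((F i)%:R : R).
Proof. by move=> Pfin; rewrite !fsbig_finite// natr_sum. Qed.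

Lemma fsumr_distrr (R : pzSemiRingType) (I : choiceType) (a : R) (P : set I)
    (F : I -> R) :
  finite_set P -> a * (\sum_(i \in P) F i) = \sum_(i \in P) a * F i.
Proof. by move=> Pfin; rewrite !fsbig_finite// mulr_sumr. Qed.

Lemma fsumr_distrl (R : pzSemiRingType) (I : choiceType) (a : R) (P : set I)
    (F : I -> R) :
  finite_set P -> (\sum_(i \in P) F i) * a = \sum_(i \in P) F i * a.
Proof. by move=> Pfin; rewrite !fsbig_finite// mulr_suml. Qed.

(** * Cardinalities of finite sets *)

Section Ncard.
Implicit Types I J : choiceType.

Lemma ncardE I (A : set I) : finite_set A -> ncard A = \sum_(i \in A) 1%N.
Proof. by move=> Afin; rewrite fsbig_finite// sum1_size. Qed.

Lemma ncard_bij I J (A : set I) (B : set J) (f : I -> J) :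
  finite_set A -> set_bij A B f -> ncard A = ncard B.
Proof.
move=> Afin fAB; have Bfin : finite_set B.
  have [fun_f _ surj_f] := fAB.
  by apply: sub_finite_set (finite_image f Afin).
by rewrite !ncardE// (reindex_fsbig f A B).
Qed.

Lemma ncard_fiber I J (A : set I) (B : set J) (f : I -> J) :
  finite_set A -> finite_set B -> (forall i, A i -> B (f i)) ->
  ncard A = \sum_(j \in B) ncard (A `&` f @^-1` [set j]).
Proof.
move=> Afin Bfin AB; rewrite ncardE// (fsum_fiber _ Afin Bfin AB).
by apply: eq_fsbigr => j _; rewrite ncardE//; exact: finite_setIl.
Qed.

Lemma ncard_gt0 I (A : set I) x : finite_set A -> A x -> (0 < ncard A)%N.
Proof.
move=> Afin Ax; rewrite /ncard cardfs_gt0; apply/fset0Pn; exists x.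
by rewrite in_fset_set ?inE.
Qed.

Lemma ncard0 I : ncard (set0 : set I) = 0%N.
Proof. by rewrite /ncard fset_set0. Qed.

Lemma ncard_eq1 I (A : set I) x y : finite_set A -> ncard A = 1%N ->
  A x -> A y -> x = y.
Proof.
move=> Afin /eqP/cardfs1P[z Az].
have E t : A t -> t = z.
  by move=> At; apply/eqP; rewrite -in_fset1 -Az in_fset_set ?inE.
by move=> /E -> /E ->.
Qed.

Lemma ncardX I J (A : set I) (B : set J) : finite_set A -> finite_set B ->
  ncard (A `*` B) = (ncard A * ncard B)%N.
Proof.
move=> Afin Bfin; rewrite ncardE; last exact: finite_setX.
rewrite -(@pair_fsbig _ _ _ _ _ _ _ (fun _ _ => 1%N))// !ncardE//.
rewrite -[muln _ _]/(GRing.mul _ _) fsumr_distrl//; apply: eq_fsbigr => i _.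
by rewrite mul1r.
Qed.

Lemma fsum_const (R : pzSemiRingType) I (A : set I) (F : I -> R) (c : R) :
  finite_set A -> (forall i, A i -> F i = c) ->
  \sum_(i \in A) F i = (ncard A)%:R * c.
Proof.
move=> Afin Fc; rewrite ncardE// natr_fsum// fsumr_distrl//.
by apply: eq_fsbigr => i /set_mem/Fc ->; rewrite mul1r.
Qed.

End Ncard.

(** * Coset spaces, their fixed points and indices *)

Section Cosets.
Variable G : profiniteGroupType.
Implicit Types (g h : G) (A B H : set G) (U V W X Y : open_subgroup G).

Lemma osg_ext U V : osg_set U = osg_set V -> U = V.
Proof.
case: U V => [A oA A1 AM AV] [B oB B1 BM BV] /= AB.
by case: _ / AB in oB B1 BM BV *; congr OpenSubgroup; exact: Prop_irrelevance.
Qed.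

Lemma conj_setE g A x : conj_set g A x = A (g^-1 * x * g)%g.
Proof.
apply/propext; split; first by move=> [a Aa <-]; rewrite -!mulgA mulVg mulg1 mulKg.
by move=> Ax; exists (g^-1 * x * g)%g; rewrite // -!mulgA mulgV mulg1 mulVKg.
Qed.

Lemma left_cosetE g A x : left_coset g A x = A (g^-1 * x)%g.
Proof.
apply/propext; split; first by move=> [a Aa <-]; rewrite mulKg.
by move=> Ax; exists (g^-1 * x)%g; rewrite // mulVKg.
Qed.

Lemma conj_setS g A B : A `<=` B -> conj_set g A `<=` conj_set g B.
Proof. by move=> AB x; rewrite !conj_setE; exact: AB. Qed.

Lemma sub_conj_setV g A B : (conj_set g^-1%g A `<=` B) = (A `<=` conj_set g B).
Proof.
apply/propext; split=> [/(conj_setS (g := g))|/(conj_setS (g := g^-1%g))];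
by rewrite conj_setM ?mulgV ?mulVg conj_set1.
Qed.

Lemma left_cosetM g h A : left_coset g (left_coset h A) = left_coset (g * h)%g A.
Proof. by apply/seteqP; split=> x; rewrite !left_cosetE invgM mulgA. Qed.

Lemma left_coset1 A : left_coset 1%g A = A.
Proof. by apply/seteqP; split=> x; rewrite left_cosetE invg1 mul1g. Qed.

Lemma left_coset_inj g : injective (left_coset g : set G -> set G).
Proof.
move=> A B /(congr1 (left_coset g^-1%g)).
by rewrite !left_cosetM mulVg !left_coset1.
Qed.

Lemma left_coset_self g V : left_coset g V g.
Proof. by rewrite left_cosetE mulVg; exact: osg1. Qed.

Lemma osg_mull V x y : osg_set V x -> osg_set V (x * y)%g = osg_set V y.
Proof.
move=> Vx; apply/propext; split=> [Vxy|]; last exact: osgM.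
by rewrite -(mulKg x y); apply: osgM => //; exact: osgV.
Qed.

Lemma osg_mulr V x y : osg_set V x -> osg_set V (y * x)%g = osg_set V y.
Proof.
move=> Vx; apply/propext; split=> [Vxy|Vy]; last exact: osgM.
by rewrite -(mulgK x y); apply: osgM => //; exact: osgV.
Qed.

Lemma osg_inv V x : osg_set V x^-1%g = osg_set V x.
Proof.
by apply/propext; split=> [/osgV|]; [rewrite invgK | exact: osgV].
Qed.

Lemma left_coset_eq g h V :
  (left_coset g V = left_coset h V) = osg_set V (g^-1 * h)%g.
Proof.
apply/propext; split=> [E|Vgh].
  by have := left_coset_self h V; rewrite -E left_cosetE.
apply/seteqP; split=> x; rewrite !left_cosetE => Vx.
  have -> : (h^-1 * x = (g^-1 * h)^-1 * (g^-1 * x))%g.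
    by rewrite invgM invgK -!mulgA mulVKg.
  by rewrite osg_mull// osg_inv.
by rewrite -(mulVKg h x) mulgA osg_mull.
Qed.

Lemma mulg_continuousl (g : G) : continuous (fun x : G => g * x)%g.
Proof.
move=> x; apply: (@cvg_comp2 _ _ _ _ (nbhs x) (nbhs g) (nbhs x) _ _ _ _
  (fun=> g) id (fun x y => x * y)%g).
- exact: cvg_cst.
- exact: cvg_id.
- exact: (@mulg_continuous G (g, x)).
Qed.

Lemma mulg_continuousr (g : G) : continuous (fun x : G => x * g)%g.
Proof.
move=> x; apply: (@cvg_comp2 _ _ _ _ (nbhs x) (nbhs x) (nbhs g) _ _ _ _
  id (fun=> g) (fun x y => x * y)%g).
- exact: cvg_id.
- exact: cvg_cst.
- exact: (@mulg_continuous G (x, g)).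
Qed.

Lemma left_coset_open g V : open (left_coset g V).
Proof.
rewrite (_ : left_coset g V = (fun x => g^-1 * x)%g @^-1` V).
  apply: open_comp; last exact: osg_open.
  by move=> x _; exact: mulg_continuousl.
by apply/seteqP; split=> x; rewrite left_cosetE.
Qed.

Lemma conj_set_open g V : open (conj_set g V).
Proof.
rewrite (_ : conj_set g V = (fun x => x * g)%g @^-1` left_coset g V).
  apply: open_comp; last exact: left_coset_open.
  by move=> x _; exact: mulg_continuousr.
by apply/seteqP; split=> x; rewrite conj_setE /= left_cosetE mulgA.
Qed.

Definition osg_conj g V : open_subgroup G.
Proof.
refine (@OpenSubgroup G (conj_set g V) (conj_set_open g V) _ _ _).
- by rewrite conj_setE mulg1 mulVg; exact: osg1.
- move=> x y; rewrite !conj_setE => Vx Vy.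
  rewrite (_ : (_ * _ = (g^-1 * x * g) * (g^-1 * y * g))%g); first exact: osgM.
  by rewrite -!mulgA mulVKg.
- by move=> x; rewrite !conj_setE -osg_inv !invgM !invgK mulgA.
Defined.

Definition osg_cap V W : open_subgroup G.
Proof.
refine (@OpenSubgroup G (V `&` W) (openI (osg_open V) (osg_open W)) _ _ _).
- by split; exact: osg1.
- by move=> x y [Vx Wx] [Vy Wy]; split; exact: osgM.
- by move=> x [Vx Wx]; split; exact: osgV.
Defined.

Definition osgT : open_subgroup G :=
  @OpenSubgroup G setT openT I (fun _ _ _ _ => I) (fun _ _ => I).

(** The fixed points of [A] on [H/V]: [a h V = h V] for all [a] in [A] means that [A] lies in
    [h V h^-1]. *)
Definition fixed_coset_set A H V : set (set G) :=
  [set C | exists h, [/\ H h, A `<=` conj_set h V & C = left_coset h V]].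

Lemma fixed_cosetsE A H V : fixed_cosets A H V = ncard (fixed_coset_set A H V).
Proof.
congr ncard; apply/seteqP; split=> C.
  move=> [[h Hh ->] CA]; exists h; split=> // a /CA.
  rewrite left_cosetM => E; rewrite conj_setE -osg_inv.
  by move: E; rewrite left_coset_eq !invgM invgK mulgA.
move=> [h [Hh AV ->]]; split; first by exists h.
move=> a /AV; rewrite conj_setE => Va.
by rewrite left_cosetM left_coset_eq -osg_inv !invgM !invgK mulgA.
Qed.

Definition cosets H V : set (set G) :=
  [set C | exists2 h, H h & C = left_coset h V].

(** The left cosets of [V] form an open cover of [G]. By compactness finitely many of them cover
    [G], and every coset equals one of these because it meets it. *)
Lemma finite_cosets H V : finite_set (cosets H V).
Proof.
pose Gp : ptopologicalType :=
  HB.pack (ProfiniteGroup.sort G) (isPointed.Build G 1%g).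
have : compact [set: Gp] by exact: (@profinite_compact G).
rewrite compact_cover.
move=> /(_ G setT (fun g => left_coset g V)) [].
- by move=> g _; exact: left_coset_open.
- by move=> g _; exists g => //; exact: left_coset_self.
move=> D _ GD; apply: (@sub_finite_set _ _ ((fun g => left_coset g V) @` [set` D])).
  move=> _ [h _ ->]; have [d Dd] := GD h I; rewrite left_cosetE => Vdh.
  by exists d; rewrite ?left_coset_eq.
exact: finite_image.
Qed.

Lemma fixed_coset_set_sub A H V : fixed_coset_set A H V `<=` cosets H V.
Proof. by move=> C [h [Hh _ ->]]; exists h. Qed.

Lemma finite_fixed_coset_set A H V : finite_set (fixed_coset_set A H V).
Proof. exact: sub_finite_set (@fixed_coset_set_sub A H V) (finite_cosets H V). Qed.

(** The trivial group fixes every coset; facts about indices thus become special cases of facts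
    about fixed points. *)
Lemma index_inE H V : index_in H V = fixed_cosets [set 1%g] H V.
Proof.
rewrite fixed_cosetsE; congr ncard; apply/seteqP; split=> C.
  by move=> [h Hh ->]; exists h; split=> // _ ->; exact: (osg1 (osg_conj h V)).
by move=> [h [Hh _ ->]]; exists h.
Qed.

Lemma index_in_gt0 (H V : open_subgroup G) : (0 < index_in H V)%N.
Proof.
apply: (ncard_gt0 (finite_cosets H V)).
by exists 1%g; [exact: osg1 | reflexivity].
Qed.

(** The coset of [1] is fixed. These counts are the diagonal coefficients of the triangular systems
    below. *)
Lemma fixed_cosets_self_gt0 (H U : open_subgroup G) :
  (0 < fixed_cosets U H U)%N.
Proof.
rewrite fixed_cosetsE; apply: ncard_gt0; first exact: finite_fixed_coset_set.
by exists 1%g; split; [exact: osg1 | rewrite conj_set1 | reflexivity].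
Qed.

Lemma fixed_cosets_eq0 A H V : ~ subconjugate_in H A V -> fixed_cosets A H V = 0%N.
Proof.
move=> AV; rewrite fixed_cosetsE (_ : fixed_coset_set A H V = set0) ?ncard0//.
by apply/seteqP; split=> // C [h [Hh hA _]]; apply: AV; exists h.
Qed.

Lemma fixed_cosets_conjl (H : open_subgroup G) h A V : osg_set H h ->
  fixed_cosets (conj_set h A) H V = fixed_cosets A H V.
Proof.
move=> Hh; rewrite !fixed_cosetsE; apply/esym.
apply: (@ncard_bij _ _ _ _ (left_coset h)).
  exact: finite_fixed_coset_set.
split.
- move=> _ [k [Hk Ak ->]]; exists (h * k)%g; split; first exact: osgM.
    by rewrite -conj_setM; exact: conj_setS.
  by rewrite left_cosetM.
- by move=> C D _ _; exact: left_coset_inj.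
- move=> _ [k [Hk Ak ->]]; exists (left_coset (h^-1 * k)%g V).
    exists (h^-1 * k)%g; split=> //; first by apply: osgM => //; exact: osgV.
    by rewrite -conj_setM -sub_conj_setV invgK.
  by rewrite left_cosetM mulVKg.
Qed.

Lemma left_coset_conj g h V :
  left_coset g (conj_set h V) = (fun x => x * h)%g @^-1` left_coset (g * h)%g V.
Proof.
by apply/seteqP; split=> x; rewrite /= !left_cosetE conj_setE invgM !mulgA.
Qed.

(** Right translation identifies [H/V] with [H/(h V h^-1)], since [k V h^-1 = (k h^-1) (h V h^-1)],
    and it commutes with the left action. *)
Lemma fixed_cosets_conjr (H : open_subgroup G) h A V : osg_set H h ->
  fixed_cosets A H (osg_conj h V) = fixed_cosets A H V.
Proof.
move=> Hh; rewrite !fixed_cosetsE.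
apply/esym.
apply: (@ncard_bij _ _ _ _ (fun C => (fun x => x * h)%g @^-1` C)).
  exact: finite_fixed_coset_set.
split.
- move=> _ [k [Hk Ak ->]]; exists (k * h^-1)%g; split.
  + by apply: osgM => //; exact: osgV.
  + by rewrite conj_setM mulgVK.
  + by rewrite left_coset_conj mulgVK.
- move=> C D _ _ CD; apply/seteqP; split=> x;
    by have := congr1 (fun S : set G => S (x * h^-1)%g) CD; rewrite /preimage/= mulgVK => ->.
- move=> _ [k [Hk Ak ->]]; exists (left_coset (k * h)%g V).
    by exists (k * h)%g; split; [exact: osgM | rewrite -conj_setM|].
  by rewrite left_coset_conj.
Qed.

(* [G/Y -> G/X] is [A]-equivariant, and the fibre over a fixed coset [g X] is a
   translate of [X/Y], on which [A] acts through its conjugate by [g^-1]. *)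
Lemma fixed_cosets_tower (H X Y : open_subgroup G) A :
  X `<=` H -> Y `<=` X ->
  fixed_cosets A H Y =
  \sum_(C \in fixed_coset_set A H X)
    fixed_cosets (conj_set (xget 1%g C)^-1%g A) X Y.
Proof.
(* [f C] is the product [C X], so [f] is the projection from [H/Y] to [H/X]. *)
move=> XH YX; pose f (C : set G) :=
  [set z | exists c x, [/\ C c, osg_set X x & z = (c * x)%g]].
have fE g : f (left_coset g Y) = left_coset g X.
  apply/seteqP; split=> z.
    move=> [c [x [/= + Xx ->]]]; rewrite !left_cosetE mulgA => /YX Xc.
    exact: osgM.
  rewrite left_cosetE => Xz; exists g, (g^-1 * z)%g; split=> //.
    exact: left_coset_self.
  by rewrite mulVKg.
rewrite fixed_cosetsE (@ncard_fiber _ _ _ (fixed_coset_set A H X) f).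
- apply: eq_fsbigr => C /set_mem [h [Hh Ah CE]]; rewrite fixed_cosetsE.
  set g := xget 1%g C; have Cg : C g.
    by apply: (@xgetI _ 1%g C h); rewrite CE; exact: left_coset_self.
  have Cg' : C = left_coset g X.
    by rewrite CE left_coset_eq; move: Cg; rewrite CE left_cosetE.
  have Hg : osg_set H g.
    rewrite -(mulVKg h g); apply: osgM => //; apply: XH.
    by move: Cg; rewrite CE left_cosetE.
  apply/esym; apply: (@ncard_bij _ _ _ _ (left_coset g)).
    exact: finite_fixed_coset_set.
  split.
  + move=> _ [x [Xx Ax ->]]; split.
      exists (g * x)%g; split.
      * by apply: osgM => //; exact: XH.
      * by rewrite -conj_setM -sub_conj_setV.
      * by rewrite left_cosetM.
    rewrite /= left_cosetM fE Cg' -left_cosetM; congr left_coset.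
    by rewrite -[RHS]left_coset1 left_coset_eq mulg1 osg_inv.
  + by move=> D E _ _; exact: left_coset_inj.
  + move=> _ [[k [Hk Ak ->]] /=]; rewrite fE Cg' => E.
    have Xgk : osg_set X (g^-1 * k)%g by rewrite -left_coset_eq.
    exists (left_coset (g^-1 * k)%g Y); last by rewrite left_cosetM mulVKg.
    exists (g^-1 * k)%g; split=> //.
    by rewrite sub_conj_setV conj_setM mulVKg.
- exact: finite_fixed_coset_set.
- exact: finite_fixed_coset_set.
- move=> _ [h [Hh Ah ->]]; exists h; split; rewrite ?fE//.
  by apply: subset_trans Ah _; exact: conj_setS.
Qed.

Lemma index_in_tower (H X Y : open_subgroup G) :
  X `<=` H -> Y `<=` X ->
  index_in H Y = (index_in H X * index_in X Y)%N.
Proof.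
move=> XH YX; rewrite index_inE (fixed_cosets_tower _ XH YX) [in RHS]index_inE.
rewrite (@fsum_const nat _ _ _ (index_in X Y)).
- by rewrite natn fixed_cosetsE.
- exact: finite_fixed_coset_set.
move=> C _; rewrite index_inE; congr fixed_cosets.
by apply/seteqP; split=> [_ [_ -> <-]|_ ->]; rewrite ?mulg1 ?invgK ?mulVg//;
   exists 1%g => //; rewrite mulg1 invgK mulVg.
Qed.

Lemma index_in_conj (H : open_subgroup G) h V : osg_set H h ->
  index_in H (osg_conj h V) = index_in H V.
Proof. by move=> Hh; rewrite !index_inE fixed_cosets_conjr. Qed.

(** The conjugating element picked by [xget] does not matter, because conjugates of [V] have the
    same index in [G]. The tower formula then determines [(V : U)] as a quotient of two indices in
    [G]. *)
Lemma gindexE g U V : U `<=` conj_set g V ->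
  (gindex V U * index_in setT V)%N = index_in setT U.
Proof.
rewrite /gindex => UV; set k := xget _ _.
have Uk : U `<=` osg_conj k V.
  exact: (@xgetI _ 1%g [set g | U `<=` conj_set g V] g).
rewrite (@index_in_tower osgT (osg_conj k V) U)// mulnC; congr (_ * _)%N.
by rewrite (@index_in_conj osgT).
Qed.

Lemma gindex_gt0 g U V : U `<=` conj_set g V -> (0 < gindex V U)%N.
Proof.
move=> /gindexE E; have := index_in_gt0 osgT U; rewrite -E.
by rewrite muln_gt0 => /andP[].
Qed.

Lemma conj_set_sub (H : open_subgroup G) h V : osg_set H h -> V `<=` H ->
  conj_set h V `<=` H.
Proof.
move=> Hh VH x; rewrite conj_setE => /VH.
by rewrite osg_mulr// osg_mull// osg_inv.
Qed.

(** The tower formula forces [V/U] to have a single element, so the coset of any [v] in [V] is that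
    of [1]. *)
Lemma index_in_eq (H U V : open_subgroup G) : V `<=` H -> U `<=` V ->
  index_in H U = index_in H V -> osg_set U = V.
Proof.
move=> VH UV E; have := index_in_tower VH UV.
rewrite E -[LHS]muln1 => /eqP; rewrite eqn_pmul2l ?index_in_gt0// => /eqP/esym I1.
apply/seteqP; split=> // v Vv.
have := ncard_eq1 (finite_cosets V U) I1 (x := left_coset 1%g U) (y := left_coset v U).
rewrite left_coset_eq invg1 mul1g; apply; first by exists 1%g => //; exact: osg1.
by exists v.
Qed.

End Cosets.

(** * Conjugacy classes and triangular systems *)

Lemma inj_surj_bij (A B : Type) (f : A -> B) :
  injective f -> (forall y, exists x, f x = y) -> bijective f.
Proof.
move=> f_inj f_surj; pose s y := projT1 (cid (f_surj y)).
have sK : cancel s f by move=> y; rewrite /s; case: cid.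
by exists s => // x; apply: f_inj; rewrite sK.
Qed.

Lemma contains_rat_torsion_free (R : comNzRingType) :
  contains_rat R -> torsion_free R.
Proof.
move=> [i] n x xn; rewrite -[x]mul1r -(rmorph1 i) -[1](@mulVf _ n.+1%:R).
  by rewrite rmorphM rmorph_nat -mulrA mulr_natl xn mulr0.
by rewrite pnatr_eq0.
Qed.

Section Classes.
Variables (G : profiniteGroupType) (H : open_subgroup G).
Implicit Types (U V W : open_subgroup G).

Lemma conjugate_in_refl (A : set G) : conjugate_in H A A.
Proof. by exists 1%g; [exact: osg1 | rewrite conj_set1]. Qed.

Lemma conjugate_in_sym (A B : set G) : conjugate_in H A B -> conjugate_in H B A.
Proof.
move=> [h Hh ->]; exists h^-1%g; first exact: osgV.
by rewrite conj_setM mulVg conj_set1.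
Qed.

Lemma conjugate_in_trans (A B C : set G) :
  conjugate_in H A B -> conjugate_in H B C -> conjugate_in H A C.
Proof.
move=> [h Hh ->] [k Hk ->]; exists (k * h)%g; first exact: osgM.
by rewrite conj_setM.
Qed.

Lemma conjugate_in_sub U V : U `<=` H -> conjugate_in H U V -> V `<=` H.
Proof. by move=> UH [h Hh ->]; exact: conj_set_sub. Qed.

Lemma subconjugate_in_conjl (A B C : set G) : conjugate_in H A B ->
  subconjugate_in H A C -> subconjugate_in H B C.
Proof.
move=> [h Hh ->] [k Hk AC]; exists (h * k)%g; first exact: osgM.
by rewrite -conj_setM; exact: conj_setS.
Qed.

Lemma subconjugate_in_conjr (A B C : set G) : conjugate_in H B C ->
  subconjugate_in H A B -> subconjugate_in H A C.
Proof.
move=> [h Hh ->] [k Hk AB]; exists (k * h^-1)%g.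
  by apply: osgM => //; exact: osgV.
by rewrite conj_setM mulgVK.
Qed.

Lemma subconjugate_in_trans (A B C : set G) :
  subconjugate_in H A B -> subconjugate_in H B C -> subconjugate_in H A C.
Proof.
move=> [h Hh AB] [k Hk BC]; exists (h * k)%g; first exact: osgM.
by apply: subset_trans AB _; rewrite -conj_setM; exact: conj_setS.
Qed.

Lemma conjugate_in_subconj (A B : set G) :
  conjugate_in H A B -> subconjugate_in H A B.
Proof. by move/conjugate_in_sym=> [h Hh ->]; exists h. Qed.

Lemma class_repP V : conjugate_in H V (class_rep H V).
Proof.
apply: (@xgetI _ V [set V' : open_subgroup G | conjugate_in H V V'] V).
exact: conjugate_in_refl.
Qed.

(** The two calls of [xget] have different default values, but they choose from the same class,
    which is nonempty. *)
Lemma class_rep_eq U V : conjugate_in H U V -> class_rep H U = class_rep H V.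
Proof.
move=> UV; rewrite /class_rep.
have -> : [set V' : open_subgroup G | conjugate_in H U V'] =
          [set V' : open_subgroup G | conjugate_in H V V'].
  apply/seteqP; split=> W /=; last exact: conjugate_in_trans.
  exact/conjugate_in_trans/conjugate_in_sym.
case: xgetP => [W WE VW|none]; last by case: (none V); exact: conjugate_in_refl.
rewrite WE /xget; case: pselect => // -[]; exists V.
by apply/asboolP; exact: conjugate_in_refl.
Qed.

Lemma class_rep_transversal V : V `<=` H -> class_transversal H (class_rep H V).
Proof.
move=> VH; split; first exact: conjugate_in_sub (class_repP V).
by apply/esym/class_rep_eq; exact: class_repP.
Qed.

Lemma fixed_cosets_conjlP (A B : set G) V : conjugate_in H A B ->
  fixed_cosets A H V = fixed_cosets B H V.
Proof. by move=> [h Hh ->]; rewrite fixed_cosets_conjl. Qed.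

Lemma fixed_cosets_conjrP (A : set G) V W : conjugate_in H V W ->
  fixed_cosets A H V = fixed_cosets A H W.
Proof.
move=> [h Hh E]; rewrite (_ : W = osg_conj h V); last exact: osg_ext.
by rewrite fixed_cosets_conjr.
Qed.

Lemma index_in_conjP V W : conjugate_in H V W -> index_in H V = index_in H W.
Proof. by move=> VW; rewrite !index_inE (fixed_cosets_conjrP _ VW). Qed.

(** A subgroup containing [U] is the union of the cosets of [U] in it, hence is determined by a
    subset of the finite set [G/U]. *)
Lemma finite_oversets U : finite_set [set V | U `<=` osg_set V].
Proof.
pose K := fset_set (cosets [set: G] U).
pose P := [set \bigcup_(C in [set` s]) C | s in [set` fpowerset K]].
have Pfin : finite_set P by exact: finite_image.
apply: (@sub_finite_set _ _ (@osg_set G @^-1` P)); last first.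
  by apply: finite_preimage => //; move=> V W _ _; exact: osg_ext.
move=> V /= UV; pose s := fset_set (cosets V U).
have sE : [set` s] = cosets V U by rewrite fset_setK//; exact: finite_cosets.
exists s.
  rewrite /= fpowersetE -fset_set_sub; try exact: finite_cosets.
  by move=> C [v _ ->]; exists v.
apply/seteqP; split=> x.
  rewrite sE => -[_ [v Vv ->]]; rewrite left_cosetE => /UV.
  by rewrite osg_mull// osg_inv.
by move=> Vx; rewrite sE; exists (left_coset x U); [exists x | exact: left_coset_self].
Qed.

Definition class_above (A : set G) : set (open_subgroup G) :=
  [set V | class_transversal H V /\ subconjugate_in H A V].

Lemma finite_class_above U : finite_set (class_above U).
Proof.
apply: (@sub_finite_set _ _ (class_rep H @` [set V | U `<=` osg_set V])); last first.
  exact/finite_image/finite_oversets.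
move=> V [[VH VV] [h Hh UV]]; exists (osg_conj h V) => //.
by rewrite /= -[RHS]VV; apply/esym/class_rep_eq; exists h.
Qed.

Lemma class_above_rep U : U `<=` H -> class_above U (class_rep H U).
Proof.
move=> UH; split; first exact: class_rep_transversal.
by apply: conjugate_in_subconj; exact: class_repP.
Qed.

Lemma class_above_conj U V : conjugate_in H U V -> class_above U = class_above V.
Proof.
move=> UV; apply/seteqP; split=> W [HW sW]; split=> //.
  exact: subconjugate_in_conjl UV sW.
exact: subconjugate_in_conjl (conjugate_in_sym UV) sW.
Qed.

(** Strict triangularity: if the indices were equal, [U] would equal a conjugate of [V], and [V]
    would be the representative of the class of [U]. *)
Lemma class_above_index_lt U V : class_above U V -> V <> class_rep H U ->
  (index_in H V < index_in H U)%N.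
Proof.
move=> [VT [h Hh UV]] neq; have VH := VT.1.
have V'H : osg_conj h V `<=` H by exact: conj_set_sub.
have := index_in_tower V'H UV; rewrite index_in_conj// => E.
rewrite ltn_neqAle {2}E leq_pmulr ?index_in_gt0// andbT.
apply/eqP => E'; apply: neq.
have UE : osg_set U = osg_conj h V.
  by apply: (index_in_eq V'H UV); rewrite index_in_conj.
have VU : conjugate_in H V U by exists h.
by case: VT => _ <-; exact: class_rep_eq.
Qed.

End Classes.

(** * Unique solvability of triangular systems *)

Section Triangular.
Variables (G : profiniteGroupType) (H : open_subgroup G) (R : comNzRingType).
Variable e : open_subgroup G -> open_subgroup G -> nat.
Hypothesis e1 : forall U V : open_subgroup G, conjugate_in H U V -> e V U = 1%N.
Hypothesis e_conj : forall U U' V : open_subgroup G, conjugate_in H U U' ->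
  subconjugate_in H U V -> e V U = e V U'.
Implicit Types (U V W : open_subgroup G) (m b : open_subgroup G -> R).

Definition class_fun m := forall U V : open_subgroup G,
  U `<=` H -> conjugate_in H U V -> m U = m V.

(* [e = 1] gives the fixed point counts on [Delta_H(R)], and [e V U = (V : U)]
   the ghost maps of [W_H(R)]. *)
Definition mark_sum m U : R :=
  \sum_(V \in class_above H U) (fixed_cosets U H V)%:R * m V ^+ e V U.

(** The off-diagonal part of [mark_sum]; it involves only values of [m] at subgroups of smaller
    index than [U]. *)
Definition mark_tail m U : R :=
  \sum_(V \in class_above H U `\ class_rep H U)
    (fixed_cosets U H V)%:R * m V ^+ e V U.

(** At the class of [U] itself the exponent is 1, so the diagonal term is linear in [m U], for the
    ghost maps too. *)
Lemma mark_sumE m U : class_fun m -> U `<=` H ->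
  mark_sum m U = (fixed_cosets U H U)%:R * m U + mark_tail m U.
Proof.
move=> mcl UH; rewrite /mark_sum (fsbigD1 (class_rep H U)).
- rewrite e1 ?expr1; last exact: class_repP.
  have UU := class_repP H U.
  by rewrite -(fixed_cosets_conjrP _ UU) -(mcl _ _ UH UU).
- exact: finite_class_above.
- exact: class_above_rep.
Qed.

Lemma eq_mark_tail m m' U : U `<=` H ->
  (forall V, V `<=` H -> (index_in H V < index_in H U)%N -> m V = m' V) ->
  mark_tail m U = mark_tail m' U.
Proof.
move=> UH mm'; apply: eq_fsbigr => V /set_mem [UV neq].
by rewrite mm' ?(class_above_index_lt UV)//; case: UV => -[].
Qed.

Lemma mark_tail_conj m U U' : conjugate_in H U U' ->
  mark_tail m U = mark_tail m U'.
Proof.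
move=> UU'; rewrite /mark_tail (class_above_conj UU') (class_rep_eq UU').
apply: eq_fsbigr => V /set_mem [[_ U'V] _].
rewrite (fixed_cosets_conjlP _ UU') (e_conj UU')//.
exact: subconjugate_in_conjl (conjugate_in_sym UU') U'V.
Qed.

(** Induction on the index of [U]: the tails agree, and torsion-freeness cancels the positive
    diagonal coefficient. *)
Lemma mark_sum_inj m m' : torsion_free R -> class_fun m -> class_fun m' ->
  (forall U, U `<=` H -> mark_sum m U = mark_sum m' U) ->
  forall U, U `<=` H -> m U = m' U.
Proof.
move=> tf mcl m'cl mm' U.
have [n] := ubnP (index_in H U); elim: n U => // n IHn U Un UH.
have := mm' U UH; rewrite !mark_sumE// (@eq_mark_tail m m')//; last first.
  by move=> V VH VU; apply: IHn => //; exact: leq_trans VU _.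
move=> /addIr/eqP; rewrite -subr_eq0 -mulrBr -(prednK (fixed_cosets_self_gt0 H U)).
by rewrite mulr_natl => /eqP/tf/eqP; rewrite subr_eq0 => /eqP.
Qed.

Lemma mark_sum_surj b : contains_rat R -> class_fun b ->
  exists m, [/\ class_fun m, forall U, ~ U `<=` H -> m U = 0 &
    forall U, U `<=` H -> mark_sum m U = b U].
Proof.
move=> [i] bcl; pose inv n : R := i (n%:R^-1).
have invP n : (0 < n)%N -> n%:R * inv n = 1.
  move=> n0; rewrite -(rmorph_nat i) -rmorphM divff ?rmorph1//.
  by rewrite pnatr_eq0 -lt0n.
(* [f n] solves the equations at the subgroups of index less than [n]. *)
pose f := fix f n U : R := if n is n'.+1 then
  inv (fixed_cosets U H U) * (b U - mark_tail (f n') U) else 0.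
have f_conj n U V : U `<=` H -> conjugate_in H U V -> f n U = f n V.
  case: n => //= n UH UV; rewrite (bcl _ _ UH UV) (mark_tail_conj _ UV).
  by rewrite (fixed_cosets_conjlP _ UV) (fixed_cosets_conjrP _ UV).
(* Once the recursion depth exceeds the index of [U], the value at [U] no longer depends on it. *)
have f_stab n k U : U `<=` H -> (index_in H U < n)%N -> (index_in H U < k)%N ->
    f n U = f k U.
  elim: n k U => // n IHn [//|k] U UH Un Uk /=; congr (_ * (_ - _)).
  by apply: eq_mark_tail => // V VH VU; apply: IHn => //; exact: leq_trans VU _.
(* Depth [index + 1] is the least that reaches the equation at [U]. Outside [H] the value is 0, as
   [is_necklace] prescribes. *)
pose m U := if `[< U `<=` H >] then f (index_in H U).+1 U else 0.
have mE U : U `<=` H -> m U = f (index_in H U).+1 U by move=> UH; rewrite /m asboolT.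
have mcl : class_fun m.
  move=> U V UH UV; have VH := conjugate_in_sub UH UV.
  by rewrite !mE// (index_in_conjP UV) (f_conj _ _ _ UH UV).
exists m; split=> // [U nUH|U UH]; first by rewrite /m asboolF.
rewrite mark_sumE// mE//= mulrA invP ?mul1r ?fixed_cosets_self_gt0//.
rewrite [X in _ - X](@eq_mark_tail _ m) ?subrK// => V VH VU.
by rewrite mE//; exact: f_stab.
Qed.

End Triangular.

(** * Marks *)

Section Marks.
Variable G : profiniteGroupType.
Implicit Types (g h : G) (U V W X Y : open_subgroup G).
Local Notation T := (osgT G).

Lemma gindex_conjl U U' V : conjugate_in T U U' -> subconjugate_in T U V ->
  gindex V U = gindex V U'.
Proof.
move=> UU' UV; have [g _ Ug] := UV.
have [g' _ Ug'] := subconjugate_in_conjl UU' UV.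
apply/eqP; rewrite -(@eqn_pmul2r (index_in T V)) ?index_in_gt0//; apply/eqP.
by rewrite (gindexE Ug) (gindexE Ug') (index_in_conjP UU').
Qed.

Lemma gindex_conj1 U V : conjugate_in T U V -> gindex V U = 1%N.
Proof.
move=> UV; have [g _ Ug] := conjugate_in_subconj UV.
apply/eqP; rewrite -(@eqn_pmul2r (index_in T V)) ?index_in_gt0// mul1n.
by rewrite (gindexE Ug) (index_in_conjP UV).
Qed.

Lemma index_in_gindex g U X : U `<=` conj_set g X ->
  index_in X (osg_conj g^-1%g U) = gindex X U.
Proof.
move=> UgX; apply/eqP; rewrite -(@eqn_pmul2l (index_in T X)) ?index_in_gt0//.
rewrite [X in _ == X]mulnC (gindexE UgX) -(@index_in_tower _ T)//.
  by rewrite index_in_conj.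
by rewrite /= sub_conj_setV.
Qed.

Lemma left_coset_conj_set g h V :
  left_coset g V = left_coset h V -> conj_set g V = conj_set h V.
Proof.
rewrite left_coset_eq => Vgh; apply/seteqP; split=> x; rewrite !conj_setE => Vx.
  have -> : (h^-1 * x * h = (g^-1 * h)^-1 * (g^-1 * x * g) * (g^-1 * h))%g.
    by rewrite invgM invgK -!mulgA !mulVKg.
  by rewrite osg_mulr// osg_mull// osg_inv.
have E : (g^-1 * x * g = (g^-1 * h) * (h^-1 * x * h) * (g^-1 * h)^-1)%g.
  by rewrite invgM invgK -!mulgA !mulVKg.
by rewrite E osg_mulr ?osg_inv// osg_mull.
Qed.

(** Each such [Y] contains a conjugate of [U]. There are finitely many conjugates, as [g U g^-1]
    depends only on the coset [g U], and each has finitely many overgroups. *)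
Lemma finite_overconj U : finite_set [set Y | subconjugate_in T U (osg_set Y)].
Proof.
apply: (@sub_finite_set _ _ (\bigcup_(C in cosets T U)
    [set Y | osg_conj (xget 1%g C) U `<=` osg_set Y])); last first.
  apply: bigcup_finite; first exact: finite_cosets.
  by move=> C _; exact: finite_oversets.
move=> Y [g _ UY]; exists (left_coset g^-1%g U); first by exists g^-1%g.
rewrite /=; set k := xget _ _.
have kE : left_coset k U = left_coset g^-1%g U.
  have : left_coset g^-1%g U k.
    by apply: (@xgetI _ 1%g _ g^-1%g); exact: left_coset_self.
  by rewrite left_cosetE -left_coset_eq.
by rewrite (left_coset_conj_set kE) sub_conj_setV.
Qed.

Lemma double_coset_self g V W : double_coset V g W g.
Proof. by exists 1%g, 1%g; rewrite mul1g mulg1; split=> //; exact: osg1. Qed.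

(** If [k = v g w], conjugation by [v] carries one intersection to the other. Hence the class tested
    in [pcoef] depends only on the double coset. *)
Lemma double_coset_conj g k V W : double_coset V g W k ->
  conjugate_in T (V `&` conj_set g W) (V `&` conj_set k W).
Proof.
move=> [v [w [Vv Ww ->]]]; exists v => //; apply/seteqP; split=> x.
  move=> [Vx]; rewrite !conj_setE => Wx; split.
    by rewrite osg_mulr// osg_mull// osg_inv.
  move: Wx; rewrite !invgM !mulgA => Wx.
  have : osg_set W (w * (w^-1 * g^-1 * v^-1 * x * v * g * w) * w^-1)%g.
    by rewrite osg_mulr ?osg_inv// osg_mull.
  by rewrite conj_setE -!mulgA mulgV mulg1 mulVKg !mulgA.
rewrite !conj_setE => -[Vx Wx]; split.
  by move: Vx; rewrite osg_mulr// osg_mull// osg_inv.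
rewrite conj_setE !mulgA in Wx; rewrite conj_setE !invgM !mulgA.
have : osg_set W (w^-1 * (g^-1 * v^-1 * x * v * g) * w)%g.
  by rewrite osg_mulr// osg_mull// osg_inv.
by rewrite !mulgA.
Qed.

(* The orbits of [G/V x G/W] are indexed by the double cosets [V g W], the
   orbit of [(V, g W)] being isomorphic to [G/(V `&` g W g^-1)]. *)
Lemma fixed_cosetsM U V W :
  (fixed_cosets U T V * fixed_cosets U T W)%N =
  \sum_(X \in class_above T U) (pcoef V W X * fixed_cosets U T X)%N.
Proof.
pose P := fixed_coset_set U T V `*` fixed_coset_set U T W.
have Pfin : finite_set P by apply: finite_setX; exact: finite_fixed_coset_set.
(* [f] sends [(g V, h W)] to the double coset of [g^-1 h], which labels the orbit of the pair. *)
pose f (C : set G * set G) : set G :=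
  [set z | exists c1 c2, [/\ C.1 c1, C.2 c2 & z = (c1^-1 * c2)%g]].
have fE g h : f (left_coset g V, left_coset h W) = double_coset V (g^-1 * h)%g W.
  apply/seteqP; split=> z.
    move=> [c1 [c2 [/= C1 C2 ->]]]; exists (c1^-1 * g)%g, (h^-1 * c2)%g.
    rewrite left_cosetE in C1; rewrite left_cosetE in C2; split=> //.
      by rewrite -osg_inv invgM invgK.
    by rewrite !mulgA !mulgK.
  move=> [v [w [Vv Ww ->]]]; exists (g * v^-1)%g, (h * w)%g; split=> /=.
  + by rewrite left_cosetE mulKg osg_inv.
  + by rewrite left_cosetE mulKg.
  + by rewrite invgM invgK !mulgA.
pose Z g := osg_cap V (osg_conj g W).
have fZ g h : U `<=` conj_set h (Z g) ->
    P (left_coset h V, left_coset (h * g)%g W).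
  move=> Uh; split=> /=.
    by exists h; split=> // x /Uh; rewrite !conj_setE => -[].
  exists (h * g)%g; split=> // x /Uh; rewrite -conj_setM.
  by rewrite conj_setE => -[_]; rewrite [in X in _ -> X]conj_setE.
have fibre g : ncard (P `&` f @^-1` [set double_coset V g W]) =
    fixed_cosets U T (Z g).
  rewrite fixed_cosetsE; apply/esym.
  (* [F] maps [h Z(g)] to [(h V, h g W)]: the equivariant bijection from [G/Z(g)] to the orbit of
     [(V, g W)]. *)
  pose F (C : set G) : set G * set G :=
    ([set z | exists c v, [/\ C c, osg_set V v & z = (c * v)%g]],
     [set z | exists c w, [/\ C c, osg_set W w & z = (c * g * w)%g]]).
  have FE h : F (left_coset h (Z g)) = (left_coset h V, left_coset (h * g)%g W).
    congr pair; apply/seteqP; split=> z.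
    + move=> [c [v [+ Vv ->]]]; rewrite !left_cosetE mulgA => -[Vc _].
      by rewrite osg_mull.
    + rewrite left_cosetE => Vz; exists h, (h^-1 * z)%g.
      by rewrite mulVKg; split=> //; exact: (@left_coset_self _ _ (Z g)).
    + move=> [c [w [+ Ww ->]]]; rewrite !left_cosetE => -[_].
      by rewrite /= conj_setE invgM !mulgA (osg_mulr _ Ww).
    + rewrite left_cosetE => Wz; exists h, ((h * g)^-1 * z)%g.
      by rewrite mulVKg; split=> //; exact: (@left_coset_self _ _ (Z g)).
  apply: (@ncard_bij _ _ _ _ F); first exact: finite_fixed_coset_set.
  split.
  + move=> _ [h [_ Uh ->]]; rewrite FE; split; first exact: fZ.
    by rewrite /= fE mulKg.
  + move=> _ _ /set_mem [h [_ _ ->]] /set_mem [k [_ _ ->]].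
    rewrite !FE => -[]; rewrite !left_coset_eq => Vhk Whk; split=> //.
    by rewrite /= conj_setE; move: Whk; rewrite invgM !mulgA.
  + move=> [C1 C2] [[[g1 [_ Ug1 /= ->]] [g2 [_ Ug2 /= ->]]]] /=.
    rewrite fE => E; have := double_coset_self (g1^-1 * g2)%g V W.
    rewrite E => -[v [w [Vv Ww vgw]]].
    have E1 : left_coset (g1 * v)%g V = left_coset g1 V.
      by rewrite left_coset_eq invgM mulgVK osg_inv.
    have E2 : left_coset (g1 * v * g)%g W = left_coset g2 W.
      rewrite (_ : g2 = g1 * v * g * w)%g; last by rewrite -!mulgA (mulgA v) -vgw mulVKg.
      by rewrite left_coset_eq mulKg.
    exists (left_coset (g1 * v)%g (Z g)); last by rewrite FE E1 E2.
    exists (g1 * v)%g; split=> // u Uu; rewrite conj_setE; split.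
      by rewrite -conj_setE (left_coset_conj_set E1); exact: Ug1.
    have := Ug2 _ Uu; rewrite -(left_coset_conj_set E2) -conj_setM.
    by rewrite conj_setE.
rewrite !fixed_cosetsE -ncardX; try exact: finite_fixed_coset_set.
rewrite -/P (@ncard_fiber _ _ _ (f @` P) f Pfin); last 2 first.
- exact: finite_image.
- by move=> C PC; exists C.
(* The orbits are now grouped by the conjugacy class of their stabilizers. *)
pose r D := class_rep T (Z (xget 1%g D)).
have rE g : r (double_coset V g W) = class_rep T (Z g).
  apply/esym/class_rep_eq; apply: double_coset_conj.
  by apply: (@xgetI _ 1%g _ g); exact: double_coset_self.
rewrite (@fsum_fiber _ _ _ _ (class_above T U) r); last 3 first.
- exact: finite_image.
- exact: finite_class_above.
- move=> _ [[C1 C2] [/= [g1 [_ Ug1 ->]] [g2 [_ Ug2 ->]]] <-]; rewrite fE rE.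
  split; first exact: class_rep_transversal.
  apply: (subconjugate_in_conjr (class_repP T (Z (g1^-1 * g2)%g))).
  exists g1 => // u Uu; rewrite conj_setE; split.
    by rewrite -conj_setE; exact: Ug1.
  by rewrite -conj_setE conj_setM mulVKg; exact: Ug2.
apply: eq_fsbigr => X /set_mem [[_ XX] UX].
rewrite (@fsum_const nat _ _ _ (fixed_cosets U T X)).
- rewrite natn; congr (ncard _ * _)%N; apply/seteqP; split=> D.
    move=> [[[C1 C2] [/= [g1 [_ Ug1 ->]] [g2 [_ Ug2 ->]]] <-]]; rewrite /= fE rE.
    move=> E; exists (g1^-1 * g2)%g; split=> //.
    by rewrite -E; exact: (class_repP T (Z (g1^-1 * g2)%g)).
  (* Since [U] is subconjugate to [X], the orbit labelled by this double coset has a [U]-fixed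
     point, so the double coset is in the image of [P]. *)
  move=> [g [-> gX]]; split.
    have [h _ Uh] := subconjugate_in_conjr (conjugate_in_sym (H := T) gX) UX.
    exists (left_coset h V, left_coset (h * g)%g W); first exact: fZ.
    by rewrite fE mulKg.
  by rewrite /= rE -[RHS]XX; exact: class_rep_eq.
- by apply: finite_setIl; exact: finite_image.
move=> D [[[C1 C2] [/= [g1 [_ _ ->]] [g2 [_ _ ->]]] <-]].
rewrite /= fE rE => <-; rewrite fibre.
by apply: fixed_cosets_conjrP; exact: class_repP.
Qed.

(** * Marks and ghost maps with values in a ring *)

Section Ring.
Variable R : comNzRingType.
Implicit Types x y a : class_family G R.

Definition mark U (m : open_subgroup G -> R) : R := mark_sum T (fun _ _ => 1%N) m U.

Lemma ghostE U a : ghost U a = mark_sum T (fun V U => gindex V U) a U.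
Proof. by []. Qed.

Lemma cf_class_fun a : class_fun T a.
Proof. by move=> U V _; exact: cf_conj. Qed.

Lemma markD U x y : mark U (delta_add x y) = mark U x + mark U y.
Proof.
rewrite /mark /mark_sum !fsbig_finite; try exact: finite_class_above.
by rewrite -big_split; apply: eq_bigr => V _; rewrite !expr1 -[RHS]mulrDr.
Qed.

(** Some conjugate of [X] is an intersection of [V] with a conjugate of [W]. This cuts the sum
    defining [delta_mul] at a component above [U] down to the finitely many pairs above [U]. *)
Lemma pcoef_neq0 V W X : pcoef V W X <> 0%N ->
  subconjugate_in T X V /\ subconjugate_in T X W.
Proof.
move=> p0; suff [g /(conjugate_in_sym (H := T))/conjugate_in_subconj[h _ Xh]] :
    exists g, conjugate_in T (V `&` conj_set g W) X.
  split; first by exists h => // x /Xh; rewrite !conj_setE => -[].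
  exists (h * g)%g => // x /Xh; rewrite -conj_setM conj_setE => -[_ Wx].
  by rewrite conj_setE.
apply: contrapT => none; apply: p0; rewrite /pcoef.
rewrite (_ : [set _ | _] = set0) ?ncard0//; apply/seteqP; split=> // D.
by move=> [g [_ gX]]; apply: none; exists g.
Qed.

(** After exchanging sums, the coefficient of [x V * y W] is the sum over [X] evaluated by
    [fixed_cosetsM]. *)
Lemma markM U x y : mark U (delta_mul x y) = mark U x * mark U y.
Proof.
have finU := finite_class_above (osgT G) U.
have finUU : finite_set (class_above T U `*` class_above T U) by exact: finite_setX.
transitivity (\sum_(X \in class_above T U)
    \sum_(VW \in class_above T U `*` class_above T U)
      (pcoef VW.1 VW.2 X * fixed_cosets U T X)%:R * (x VW.1 * y VW.2)).
  apply: eq_fsbigr => X /set_mem [XT UX]; rewrite expr1 /= /delta_mul_val.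
  rewrite -(@fsbig_widen _ _ _ _ (class_above T U `*` class_above T U)).
  - rewrite fsumr_distrr//; apply: eq_fsbigr => -[V W] _ /=.
    by rewrite natrM !mulrA; congr (_ * _ * _); rewrite mulrC.
  - by move=> [V W] /= [[VT _] [WT _]].
  - move=> [V W] [[/= VT WT]] nVW /=.
    have [->|/eqP/pcoef_neq0[XV XW]] := eqVneq (pcoef V W X) 0%N.
      by rewrite !mul0r.
    by case: nVW; split; split=> //; [exact: subconjugate_in_trans UX XV|
      exact: subconjugate_in_trans UX XW].
rewrite exchange_fsbig// /mark /mark_sum fsumr_distrl//.
under [RHS]eq_fsbigr do rewrite fsumr_distrr//.
rewrite [RHS]pair_fsbig//; apply: eq_fsbigr => -[V W] _ /=.
rewrite !expr1 -fsumr_distrl// -natr_fsum// -fixed_cosetsM natrM.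
by rewrite -!mulrA; congr (_ * _); rewrite mulrCA.
Qed.

Lemma mark_inj x y : torsion_free R -> (forall U, mark U x = mark U y) -> x = y.
Proof.
move=> tf xy; apply: class_family_ext => U.
apply: (@mark_sum_inj _ T R (fun _ _ => 1%N)) => //; last first.
- by move=> V _; exact: xy.
- exact: cf_class_fun.
- exact: cf_class_fun.
Qed.

Lemma ghost_inj x y : torsion_free R -> (forall U, ghost U x = ghost U y) -> x = y.
Proof.
move=> tf xy; apply: class_family_ext => U.
apply: (@mark_sum_inj _ T R (fun V U => gindex V U)) => //; last first.
- by move=> V _; exact: xy.
- exact: cf_class_fun.
- exact: cf_class_fun.
- by move=> *; exact: gindex_conj1.
Qed.

Lemma ghost_surj (b : class_family G R) : contains_rat R ->
  exists a, forall U, ghost U a = b U.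
Proof.
move=> ratR; have [m [mcl _ mb]] := mark_sum_surj gindex_conj1 gindex_conjl
  ratR (cf_class_fun b).
exists (ClassFamily (fun U V => mcl U V (@subsetT _ _))) => U.
by rewrite ghostE mb.
Qed.

Lemma mark_conj (m : open_subgroup G -> R) U V : conjugate_in T U V ->
  mark U m = mark V m.
Proof.
move=> UV; rewrite /mark /mark_sum (class_above_conj UV).
by apply: eq_fsbigr => W _; rewrite (fixed_cosets_conjlP _ UV).
Qed.

Definition marks (x : class_family G R) : class_family G R :=
  ClassFamily (fun U V => @mark_conj x U V).

(** The necklace equations are the triangular system over [H] with all exponents 1, whose right-hand
    side is constant on [H]-classes. *)
Lemma necklaceP (H : open_subgroup G) (r : R) : contains_rat R ->
  is_necklace H r (necklace H r).
Proof.
move=> ratR; apply: xgetPex.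
have bcl : class_fun H (fun U => r ^+ index_in H U).
  by move=> U V _ UV; rewrite (index_in_conjP UV).
have [m [mcl m0 mE]] := @mark_sum_surj _ H R (fun _ _ => 1%N)
  (fun _ _ _ => erefl) (fun _ _ _ _ _ => erefl) _ ratR bcl.
by exists m; split=> // U UH; rewrite -mE.
Qed.

(** The [Y] on the right are grouped by their [G]-class [V], on which the fixed point count is
    constant; each group sums to [ind_family] at [V]. *)
Lemma mark_ind U X (m : open_subgroup G -> R) :
  \sum_(V \in class_above T U) (fixed_cosets U T V)%:R * ind_family X m V =
  \sum_(Y \in [set Y | class_transversal X Y /\ subconjugate_in T U Y])
    (fixed_cosets U T Y)%:R * m Y.
Proof.
set B := [set Y | _ /\ _].
have Bfin : finite_set B.
  by apply: sub_finite_set (finite_overconj U) => Y [].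
rewrite [RHS](@fsum_fiber _ _ _ _ (class_above T U) (class_rep T))//; last 2 first.
- exact: finite_class_above.
- move=> Y [XY UY]; split; first exact: class_rep_transversal.
  exact: subconjugate_in_conjr (class_repP T Y) UY.
apply: eq_fsbigr => V /set_mem [[_ VV] UV].
have E : B `&` class_rep T @^-1` [set V] =
    [set Y | class_transversal X Y /\ conjugate_in T Y V].
  apply/seteqP; split=> Y.
    by move=> [[XY UY] /= YV]; split=> //; rewrite -YV; exact: (class_repP T Y).
  move=> [XY YV]; split; first split=> //.
    exact: subconjugate_in_conjr (conjugate_in_sym YV) UV.
  by rewrite /= (class_rep_eq (H := T) YV).
rewrite E /ind_family fsumr_distrr; last by rewrite -E; exact: finite_setIl.
by apply: eq_fsbigr => Y /set_mem [_ YV]; rewrite (@fixed_cosets_conjrP _ T _ _ _ YV).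
Qed.

(** The tower formula splits the left side over the fixed cosets [k X]. Each contributes the
    necklace equation of [X] at [k^-1 U k], that is, [r] to the power [(X : k^-1 U k)], which is
    [gindex X U]. *)
Lemma mark_necklace U X (r : R) : contains_rat R ->
  \sum_(Y \in [set Y | class_transversal X Y /\ subconjugate_in T U Y])
    (fixed_cosets U T Y)%:R * necklace X r Y =
  (fixed_cosets U T X)%:R * r ^+ gindex X U.
Proof.
move=> ratR; set B := [set Y | _ /\ _].
have Bfin : finite_set B.
  by apply: sub_finite_set (finite_overconj U) => Y [].
have finC := @finite_fixed_coset_set G U T X.
transitivity (\sum_(Y \in B) \sum_(C \in fixed_coset_set U T X)
    (fixed_cosets (conj_set (xget 1%g C)^-1%g U) X Y)%:R * necklace X r Y).
  apply: eq_fsbigr => Y /set_mem [[YX _] _].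
  by rewrite (@fixed_cosets_tower _ T X)// natr_fsum// fsumr_distrl.
rewrite exchange_fsbig// fixed_cosetsE; apply: fsum_const => // C [g [_ Ug CE]].
set k := xget 1%g C.
have kE : left_coset g X = left_coset k X.
  rewrite left_coset_eq -left_cosetE -CE; apply: (@xgetI _ 1%g C g).
  by rewrite CE; exact: left_coset_self.
have Uk : U `<=` conj_set k X by rewrite -(left_coset_conj_set kE).
pose Uk' := osg_conj k^-1%g U.
have Uk'X : Uk' `<=` X by rewrite /= sub_conj_setV.
have [_ _ /(_ Uk' Uk'X)] := necklaceP X r ratR.
(* The two sums differ by those [Y] that contain a [G]-conjugate of [U] but no [X]-conjugate of
   [k^-1 U k]; there the fixed point count is 0. *)
rewrite (index_in_gindex Uk) => <-; apply/esym/fsbig_widen.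
  move=> Y [XY [h Xh UY]]; split=> //; exists (k * h)%g => //.
  by rewrite -conj_setM -sub_conj_setV.
move=> Y [[XY UY] nY] /=; rewrite fixed_cosets_eq0 ?mul0r// => UkY.
by apply: nY.
Qed.

Lemma mark_tau U a : contains_rat R -> mark U (tau_rat a) = ghost U a.
Proof.
move=> ratR; have finU := finite_class_above (osgT G) U.
transitivity (\sum_(V \in class_above T U) \sum_(X \in class_above T U)
    (fixed_cosets U T V)%:R * ind_family X (necklace X (a X)) V).
  apply: eq_fsbigr => V /set_mem [VT UV]; rewrite expr1 /= /tau_rat_val.
  (* If [X] is not above [U], no subgroup of [X] is conjugate to [V], so induction from [X]
     contributes 0 at [V]. *)
  rewrite -fsumr_distrr//; congr (_ * _); apply/esym/fsbig_widen => X; first by case.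
  move=> [XT nX] /=; rewrite /ind_family (_ : [set _ | _] = set0) ?fsbig_set0//.
  apply/seteqP; split=> // Y [[YX _] YV]; apply: nX; split=> //.
  have [g _ Ug] := subconjugate_in_conjr (conjugate_in_sym (H := T) YV) UV.
  exists g => //; apply: subset_trans Ug _; exact: conj_setS.
rewrite exchange_fsbig//; apply: eq_fsbigr => X _.
by rewrite mark_ind mark_necklace.
Qed.

(** Marks and ghost maps determine elements, and [tau_rat] turns ghosts into marks; a preimage of
    [y] is a family whose ghosts are the marks of [y]. *)
Lemma tau_rat_bij : contains_rat R -> bijective (@tau_rat G R).
Proof.
move=> ratR; have tf := contains_rat_torsion_free ratR; apply: inj_surj_bij.
  by move=> a b ab; apply: ghost_inj => // U; rewrite -!mark_tau// ab.
move=> y; have [a aE] := ghost_surj (marks y) ratR; exists a.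
by apply: mark_inj => // U; rewrite mark_tau// aE.
Qed.

End Ring.
End Marks.

(** * Tensor product with the rationals *)

Lemma rmorphism_of (A B : pzRingType) (h : A -> B) :
  h 1 = 1 -> {morph h : x y / x + y} -> {morph h : x y / x * y} ->
  exists h' : {rmorphism A -> B}, h' =1 h.
Proof.
move=> h1 hD hM; have hB : {morph h : x y / x - y}.
  by move=> x y; apply: (addIr (h y)); rewrite -hD !subrK.
pose h' : {rmorphism A -> B} := HB.pack h
  (GRing.isZmodMorphism.Build A B h hB) (GRing.isMonoidMorphism.Build A B h (h1, hM)).
by exists h'.
Qed.

Section RationalFractions.
Variables (R : comNzRingType) (tf : torsion_free R).
Implicit Types (r s : R) (n m : nat).
Local Notation D n := (n.+1%:R : R).

Lemma torsion_free_mulI n : injective ( *%R (D n)).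
Proof.
move=> r s /eqP; rewrite -subr_eq0 -mulrBr mulr_natl => /eqP/tf/eqP.
by rewrite subr_eq0 => /eqP.
Qed.

(* [(r, n)] stands for the fraction [r / n.+1]. *)
Definition fracr_rel (x y : R * nat) : bool := x.1 * D y.2 == y.1 * D x.2.

Lemma fracr_rel_refl : reflexive fracr_rel.
Proof. by move=> x; exact: eqxx. Qed.

Lemma fracr_rel_sym : symmetric fracr_rel.
Proof. by move=> x y; exact: eq_sym. Qed.

(** Torsion-freeness allows the middle denominator to be cancelled. *)
Lemma fracr_rel_trans : transitive fracr_rel.
Proof.
move=> [s m] [r n] [t k] /eqP /= rs /eqP /= st; apply/eqP/(@torsion_free_mulI m).
transitivity (r * D m * D k); first by rewrite /=; ring.
rewrite rs; transitivity (s * D k * D n); first by ring.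
by rewrite st /=; ring.
Qed.

Canonical fracr_equiv :=
  EquivRel fracr_rel fracr_rel_refl fracr_rel_sym fracr_rel_trans.

Definition fracr := {eq_quot fracr_rel}.

HB.instance Definition _ : EqQuotient _ fracr_rel fracr := EqQuotient.on fracr.
HB.instance Definition _ := Choice.on fracr.

Definition mkfrac r n : fracr := \pi_fracr (r, n).

Lemma mkfracP r n s m : mkfrac r n = mkfrac s m <-> r * D m = s * D n.
Proof. by split=> [/eqmodP/eqP//|E]; apply/eqmodP/eqP. Qed.

Lemma mkfracW (P : fracr -> Prop) : (forall r n, P (mkfrac r n)) -> forall x, P x.
Proof. by move=> PE x; rewrite -[x]reprK; case: (repr x). Qed.

(** Denominators are stored minus one: [(denM n m).+1] is [n.+1 * m.+1]. *)
Definition denM n m := (n * m + n + m)%N.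

Lemma denME n m : D (denM n m) = D n * D m.
Proof. by rewrite -natrM /denM; congr _%:R; rewrite mulSn mulnS; lia. Qed.

Definition fracr_lift (F : R -> nat -> R -> nat -> fracr) (x y : fracr) : fracr :=
  F (repr x).1 (repr x).2 (repr y).1 (repr y).2.

Lemma fracr_liftE (F : R -> nat -> R -> nat -> fracr) :
  (forall r n s m r' n' s' m', r * D n' = r' * D n -> s * D m' = s' * D m ->
     F r n s m = F r' n' s' m') ->
  forall r n s m, fracr_lift F (mkfrac r n) (mkfrac s m) = F r n s m.
Proof.
move=> FE r n s m; apply: FE; apply/mkfracP;
  by rewrite /mkfrac -surjective_pairing reprK.
Qed.

Definition fracr_add :=
  fracr_lift (fun r n s m => mkfrac (r * D m + s * D n) (denM n m)).
Definition fracr_mul := fracr_lift (fun r n s m => mkfrac (r * s) (denM n m)).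
Definition fracr_opp (x : fracr) := mkfrac (- (repr x).1) (repr x).2.

Lemma fracr_addE r n s m :
  fracr_add (mkfrac r n) (mkfrac s m) = mkfrac (r * D m + s * D n) (denM n m).
Proof.
apply: fracr_liftE => {}r {}n {}s {}m r' n' s' m' E1 E2; apply/mkfracP.
rewrite !denME.
transitivity (r * D n' * (D m * D m') + s * D m' * (D n * D n')); first by ring.
by rewrite E1 E2; ring.
Qed.

Lemma fracr_mulE r n s m :
  fracr_mul (mkfrac r n) (mkfrac s m) = mkfrac (r * s) (denM n m).
Proof.
apply: fracr_liftE => {}r {}n {}s {}m r' n' s' m' E1 E2; apply/mkfracP.
by rewrite !denME mulrACA E1 E2 mulrACA.
Qed.

Lemma fracr_oppE r n : fracr_opp (mkfrac r n) = mkfrac (- r) n.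
Proof.
apply/mkfracP; rewrite !mulNr; congr (- _); apply/mkfracP.
by rewrite /mkfrac -surjective_pairing reprK.
Qed.

Lemma fracr_addA : associative fracr_add.
Proof.
elim/mkfracW=> r n; elim/mkfracW=> s m; elim/mkfracW=> t k.
by rewrite !fracr_addE; apply/mkfracP; rewrite !denME; ring.
Qed.

Lemma fracr_addC : commutative fracr_add.
Proof.
elim/mkfracW=> r n; elim/mkfracW=> s m.
by rewrite !fracr_addE; apply/mkfracP; rewrite !denME; ring.
Qed.

Lemma fracr_add0 : left_id (mkfrac 0 0) fracr_add.
Proof.
by elim/mkfracW=> r n; rewrite fracr_addE; apply/mkfracP; rewrite !denME; ring.
Qed.

Lemma fracr_addN : left_inverse (mkfrac 0 0) fracr_opp fracr_add.
Proof.
elim/mkfracW=> r n; rewrite fracr_oppE fracr_addE; apply/mkfracP.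
by rewrite !denME; ring.
Qed.

HB.instance Definition _ :=
  GRing.isZmodule.Build fracr fracr_addA fracr_addC fracr_add0 fracr_addN.

Lemma fracr_mulA : associative fracr_mul.
Proof.
elim/mkfracW=> r n; elim/mkfracW=> s m; elim/mkfracW=> t k.
by rewrite !fracr_mulE; apply/mkfracP; rewrite !denME; ring.
Qed.

Lemma fracr_mulC : commutative fracr_mul.
Proof.
elim/mkfracW=> r n; elim/mkfracW=> s m.
by rewrite !fracr_mulE; apply/mkfracP; rewrite !denME; ring.
Qed.

Lemma fracr_mul1 : left_id (mkfrac 1 0) fracr_mul.
Proof.
by elim/mkfracW=> r n; rewrite fracr_mulE; apply/mkfracP; rewrite !denME; ring.
Qed.

Lemma fracr_mulDl : left_distributive fracr_mul fracr_add.
Proof.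
elim/mkfracW=> r n; elim/mkfracW=> s m; elim/mkfracW=> t k.
by rewrite !(fracr_addE, fracr_mulE); apply/mkfracP; rewrite !denME; ring.
Qed.

Lemma fracr_1neq0 : mkfrac 1 0 != mkfrac 0 0.
Proof. by apply/eqP => /mkfracP /eqP; rewrite mul0r mulr1 oner_eq0. Qed.

HB.instance Definition _ := GRing.Zmodule_isComNzRing.Build fracr
  fracr_mulA fracr_mulC fracr_mul1 fracr_mulDl fracr_1neq0.

Lemma mkfracD r n s m :
  mkfrac r n + mkfrac s m = mkfrac (r * D m + s * D n) (denM n m).
Proof. exact: fracr_addE. Qed.

Lemma mkfracM r n s m : mkfrac r n * mkfrac s m = mkfrac (r * s) (denM n m).
Proof. exact: fracr_mulE. Qed.

Definition rat_fracr (q : rat) : fracr := mkfrac (numq q)%:~R `|denq q|.-1.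

Lemma ratP (q : rat) : exists (a : int) n, q = a%:~R / n.+1%:R.
Proof.
exists (numq q), `|denq q|.-1; rewrite prednK ?absz_gt0 ?denq_neq0//.
by rewrite pmulrn absz_denq divq_num_den.
Qed.

(** The given fraction need not be reduced, so it is compared with the reduced one by
    cross-multiplication in [rat]. *)
Lemma rat_fracrE (a : int) n : rat_fracr (a%:~R / n.+1%:R) = mkfrac a%:~R n.
Proof.
set q := _ / _; apply/mkfracP.
rewrite prednK ?absz_gt0 ?denq_neq0// !pmulrn absz_denq -!rmorphM /=.
congr _%:~R; apply: (@intr_inj rat); rewrite !rmorphM /= numqE /q.
by rewrite mulrAC -pmulrn mulfVK ?pnatr_eq0.
Qed.

Lemma rat_fracr_rmorph : exists i : {rmorphism rat -> fracr}, i =1 rat_fracr.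
Proof.
have denV n m : (denM n m).+1%:R = n.+1%:R * m.+1%:R :> rat.
  by rewrite -natrM /denM; congr _%:R; rewrite mulSn mulnS; lia.
have n0 n : n.+1%:R != 0 :> rat by rewrite pnatr_eq0.
apply: rmorphism_of.
- by rewrite (_ : 1 = 1%:~R / 1%:R) ?rat_fracrE//.
- move=> p q; have [a [n ->]] := ratP p; have [b [m ->]] := ratP q.
  rewrite !rat_fracrE mkfracD
    (_ : _ + _ = (a * m.+1%:Z + b * n.+1%:Z)%:~R / (denM n m).+1%:R).
    by rewrite rat_fracrE rmorphD !rmorphM /=.
  rewrite denV rmorphD !rmorphM /= -!pmulrn; field.
  by rewrite !nat1r !n0.
- move=> p q; have [a [n ->]] := ratP p; have [b [m ->]] := ratP q.
  rewrite !rat_fracrE mkfracM (_ : _ / _ * _ = (a * b)%:~R / (denM n m).+1%:R).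
    by rewrite rat_fracrE rmorphM.
  by rewrite denV rmorphM /= invfM mulrACA.
Qed.

Lemma mkfrac_rmorph :
  exists2 j : {rmorphism R -> fracr}, j =1 mkfrac^~ 0%N & injective j.
Proof.
have [j jE] : exists j : {rmorphism R -> fracr}, j =1 mkfrac^~ 0%N.
  apply: rmorphism_of => // r s.
    by rewrite mkfracD; apply/mkfracP; rewrite denME; ring.
  by rewrite mkfracM; apply/mkfracP; rewrite denME; ring.
exists j => // r s; rewrite !jE => /mkfracP.
by rewrite !mulr1.
Qed.

(** The universal map sends [r / n.+1] to [f r * g (1 / n.+1)]. It is the only one because
    [mkfrac r n] is [j r * i (1 / n.+1)]. *)
Lemma fracr_tensor (j : {rmorphism R -> fracr}) (i : {rmorphism rat -> fracr}) :
  j =1 mkfrac^~ 0%N -> i =1 rat_fracr -> is_tensor_rat j i.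
Proof.
move=> jE iE T f g.
pose gV n := g n.+1%:R^-1.
have gVK n : n.+1%:R * gV n = 1.
  by rewrite -(rmorph_nat g) -rmorphM divff ?rmorph1// pnatr_eq0.
have gV0 : gV 0%N = 1 by rewrite -[LHS]mul1r; exact: (gVK 0%N).
have gVM n m : gV (denM n m) = gV n * gV m.
  rewrite /gV -rmorphM; congr (g _); rewrite -invfM -natrM; congr (_%:R^-1).
  by rewrite /denM mulSn mulnS; lia.
pose h (x : fracr) := f (repr x).1 * gV (repr x).2.
have hE r n : h (mkfrac r n) = f r * gV n.
  rewrite /h; case E : (repr (mkfrac r n)) => [s m] /=.
  have : mkfrac s m = mkfrac r n by rewrite /mkfrac -E reprK.
  move=> /mkfracP/(congr1 f); rewrite !rmorphM !rmorph_nat => fE.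
  transitivity (f s * n.+1%:R * gV n * gV m).
    by rewrite -(mulrA (f s)) gVK mulr1.
  by rewrite fE mulrAC -(mulrA (f r)) gVK mulr1.
have [h' h'E] : exists h' : {rmorphism fracr -> T}, h' =1 h.
  apply: rmorphism_of.
  - by rewrite -[1]/(mkfrac 1 0) hE rmorph1 mul1r gV0.
  - elim/mkfracW=> r n; elim/mkfracW=> s m.
    rewrite mkfracD !hE gVM rmorphD !rmorphM !rmorph_nat mulrDl.
    transitivity (f r * gV n * (m.+1%:R * gV m) + f s * gV m * (n.+1%:R * gV n)).
      by ring.
    by rewrite !gVK !mulr1.
  - elim/mkfracW=> r n; elim/mkfracW=> s m.
    by rewrite mkfracM !hE gVM rmorphM mulrACA.
have mkfracE r n : mkfrac r n = j r * i n.+1%:R^-1.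
  rewrite jE iE -[_^-1]mul1r (rat_fracrE 1) mkfracM; apply/mkfracP.
  by rewrite denME; ring.
exists h'; split.
- by move=> r /=; rewrite h'E jE hE gV0 mulr1.
- move=> q /=; have [a [n ->]] := ratP q.
  by rewrite h'E iE rat_fracrE hE rmorphM rmorph_int /gV rmorph_int.
- move=> k kj ki; elim/mkfracW => r n; rewrite mkfracE !rmorphM.
  have := kj r; have := ki n.+1%:R^-1; rewrite /= => -> ->.
  rewrite h'E jE hE h'E iE -[X in rat_fracr X]mul1r (rat_fracrE 1) hE.
  by rewrite rmorph1 mul1r gV0 mulr1.
Qed.

End RationalFractions.

Lemma tensor_rat_exists (R : comNzRingType) : torsion_free R ->
  exists (S : comNzRingType) (j : {rmorphism R -> S}) (i : {rmorphism rat -> S}),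
    is_tensor_rat j i /\ injective j.
Proof.
move=> tf; have [j jE j_inj] := mkfrac_rmorph tf.
have [i iE] := rat_fracr_rmorph tf.
by exists (fracr tf), j, i; split=> //; exact: fracr_tensor.
Qed.

(** By the universal property, the embedding into the concrete ring of fractions factors through
    [j]. *)
Lemma is_tensor_rat_inj (R S : comNzRingType) (j : {rmorphism R -> S})
    (i : {rmorphism rat -> S}) :
  torsion_free R -> is_tensor_rat j i -> injective j.
Proof.
move=> tf univ; have [S' [j' [i' [_ j'_inj]]]] := tensor_rat_exists tf.
have [h [hj _ _]] := univ S' j' i'.
by move=> r s rs; apply: j'_inj; rewrite -!hj /= rs.
Qed.

(** * Presentation of a ring by a torsion-free one *)

Lemma torsion_free_cover (R : comNzRingType) :
  exists (R' : comNzRingType) (rho : {rmorphism R' -> R}),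
    torsion_free R' /\ set_surj setT setT rho.
Proof.
pose ev (m : cmonom R) : R := \prod_(r <- finsupp m) r ^+ m r.
(* Products over a common larger support let two monomials be compared factor by factor. *)
have evE (m : cmonom R) (d : {fset R}) : (finsupp m `<=` d)%fset ->
    ev m = \prod_(r <- d) r ^+ m r.
  move=> md; rewrite /ev; apply: big_fset_incl => // r rd.
  by move=> /fsfun_dflt ->.
have ev_mm : mmorphism ev.
  split=> [m m'|]; last by rewrite /ev mdom1 big_seq_fset0.
  rewrite !(evE _ (finsupp m `|` finsupp m')%fset) ?fsubsetUl ?fsubsetUr//.
    rewrite -big_split; apply: eq_bigr => r _ /=.
    by rewrite -exprD cmM.
  by rewrite mdomD.
pose h : MMorphism.type _ R := HB.pack ev (isMultiplicative.Build _ R ev ev_mm).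
(* [int] adjoined with one indeterminate for each element of [R]. *)
pose rho : {rmorphism malg (cmonom R) int -> R} := mmap intr h.
exists (malg (cmonom R) int), rho; split.
  move=> n x /malgP xn; apply/malgP => m; apply/eqP.
  by move: (xn m); rewrite mcoeffMn mcoeff0 => /eqP; rewrite mulrn_eq0.
move=> r _; exists (mkmalgU (ucm r) 1) => //.
rewrite /rho /= mmapU /= rmorph1 mul1r (evE _ [fset r]%fset).
  by rewrite big_seq_fset1 ucmE eqxx expr1.
by rewrite mdomU.
Qed.

(** * Comparison of the two functors *)

Section Comparison.
Variables (G : profiniteGroupType) (W : witt_burnside G).
Implicit Types (A B R : comNzRingType).

Lemma ghostD R U (a b : wb_obj W R) : ghost U (a + b) = ghost U a + ghost U b.
Proof. by rewrite -!(wb_ghostE W) rmorphD. Qed.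

Lemma ghostM R U (a b : wb_obj W R) : ghost U (a * b) = ghost U a * ghost U b.
Proof. by rewrite -!(wb_ghostE W) rmorphM. Qed.

(** Both sides have the same marks, since marks and ghost maps are additive; marks are faithful
    here. *)
Lemma tau_ratD R (a b : wb_obj W R) : contains_rat R ->
  tau_rat (a + b) = delta_add (tau_rat a) (tau_rat b).
Proof.
move=> ratR; apply: mark_inj => [|U]; first exact: contains_rat_torsion_free.
by rewrite markD !mark_tau// ghostD.
Qed.

Lemma tau_ratM R (a b : wb_obj W R) : contains_rat R ->
  tau_rat (a * b) = delta_mul (tau_rat a) (tau_rat b).
Proof.
move=> ratR; apply: mark_inj => [|U]; first exact: contains_rat_torsion_free.
by rewrite markM !mark_tau// ghostM.
Qed.

(** Composition with a set-theoretic section of [f] keeps a family constant on conjugacy classes. *)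
Lemma wb_lift A B (f : {rmorphism A -> B}) (b : wb_obj W B) :
  set_surj setT setT f -> exists a : wb_obj W A, wb_map W f a = b.
Proof.
move=> f_surj; have surj y : exists x, f x = y.
  by have [x _ xy] := f_surj y I; exists x.
pose s y := projT1 (cid (surj y)).
exists (cf_map s b); rewrite wb_mapE; apply: class_family_ext => U /=.
by rewrite /s; case: cid.
Qed.

(** The ring structure is known only through the ghost maps. Over a torsion-free ring they identify
    the zero element, since the zero family has zero ghosts; a ring mapping onto [R] transports
    this. *)
Lemma wb_zeroE R U : (0 : wb_obj W R) U = 0.
Proof.
suff [R' [rho [tf zero]]] : exists R' (rho : {rmorphism R' -> R}),
    torsion_free R' /\ forall U, (0 : wb_obj W R') U = 0.
  by rewrite -(rmorph0 (wb_map W rho)) wb_mapE /= zero rmorph0.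
have [R' [rho [tf _]]] := torsion_free_cover R; exists R', rho; split=> // {}U.
have zero_conj (V V' : open_subgroup G) :
  conjugate_in [set: G] V V' -> (0 : R') = 0 by [].
rewrite (_ : (0 : wb_obj W R') = ClassFamily zero_conj)//.
apply: ghost_inj => // V; rewrite -(wb_ghostE W) rmorph0 /ghost fsbigop.fsbig1//.
(* The exponent is positive, so the power of 0 is 0 and not 1. *)
move=> X [_ [g _ VX]] /=; rewrite expr0n.
by rewrite (gtn_eqF (gindex_gt0 VX)) mulr0.
Qed.

(** This identifies [W_G(ker f)], described by values, with the kernel of [W_G(f)]. *)
Lemma wb_map_eq0 A B (f : {rmorphism A -> B}) (a : wb_obj W A) :
  wb_map W f a = 0 <-> forall U, f (a U) = 0.
Proof.
rewrite wb_mapE; split=> [fa0 U|fa0].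
  by have := congr1 (fun x : wb_obj W B => x U) fa0; rewrite wb_zeroE.
by apply: class_family_ext => U; rewrite wb_zeroE /= fa0.
Qed.

Lemma cf_map_inj A B (f : A -> B) : injective f -> injective (@cf_map G A B f).
Proof.
move=> f_inj a b ab; apply: class_family_ext => U; apply: f_inj.
exact: (congr1 (fun x : class_family G B => x U) ab).
Qed.

Lemma wb_is_Delta : is_Delta (D := W) (fun R (a : class_family G R) => a : wb_obj W R).
Proof.
split.
- move=> R ratR; exists (@tau_rat G R); split=> //.
  + exact: tau_rat_bij.
  + by move=> a b; exact: tau_ratD.
  + by move=> a b; exact: tau_ratM.
- move=> R tf _; have [S [j [i [univ j_inj]]]] := tensor_rat_exists tf.
  have ratS : contains_rat S by split.
  exists S, j, i, (fun a => tau_rat (cf_map j a)); split=> //.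
  + split=> // a b /(bij_inj (tau_rat_bij _ ratS)) H.
    by apply: (cf_map_inj j_inj); apply: H; exact: contains_rat_torsion_free.
  (* Addition in [W_G] is not componentwise; [cf_map j] preserves it because it is the ring morphism
     [wb_map W j]. *)
  + move=> a b; rewrite -[cf_map j (a + b)](wb_mapE W j) rmorphD tau_ratD//.
    by rewrite !wb_mapE.
  + move=> a b; rewrite -[cf_map j (a * b)](wb_mapE W j) rmorphM tau_ratM//.
    by rewrite !wb_mapE.
- move=> R _; have [R' [rho [tf rho_surj]]] := torsion_free_cover R.
  exists R', rho, (wb_map W rho); split=> //.
  + by move=> b _; have [a <-] := wb_lift b rho_surj; exists a.
  + by apply/seteqP; split=> [a /wb_map_eq0 a0|_ [a /= a0 <-]];
      [exists a | exact/wb_map_eq0].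
  + by move=> a; rewrite wb_mapE.
- by move=> A B f a; exact: wb_mapE.
Qed.

(** * Every model of [Delta_G] is isomorphic to [W_G] *)

Section Delta.
Variables (D : ring_functor) (tau : forall R, class_family G R -> D R).
Arguments tau {R}.

(** Preservation of 1 is not listed, as the comparison maps [e] come with sums and products only; it
    follows from surjectivity and multiplicativity. *)
Definition ring_iso R (f : wb_obj W R -> D R) : Prop :=
  [/\ bijective f, {morph f : a b / a + b} & {morph f : a b / a * b}].

Lemma delta_rational_iso R : contains_rat R -> delta_rational (@tau) R ->
  ring_iso (@tau R).
Proof.
move=> ratR [e [e_bij eD eM eE]]; have e_inj := bij_inj e_bij.
split.
- have [e' eK e'K] := e_bij.
  apply: (@eq_bij _ _ (e' \o @tau_rat G R)).
    by apply: bij_comp; [exists e | exact: tau_rat_bij].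
  by move=> a /=; rewrite -eE eK.
- by move=> a b; apply: e_inj; rewrite eD !eE tau_ratD.
- by move=> a b; apply: e_inj; rewrite eM !eE tau_ratM.
Qed.

(** The composite of [tau] with [e] is [tau_rat] after [cf_map j], which is injective and has the
    same range as [e]. *)
Lemma delta_torsion_free_iso R : torsion_free R -> delta_torsion_free (@tau) R ->
  ring_iso (@tau R).
Proof.
move=> tf [S [j [i [e [univ [e_inj eR] eD eM eE]]]]].
have ratS : contains_rat S by split.
have j_inj := is_tensor_rat_inj tf univ.
split.
- apply: inj_surj_bij.
    move=> a b /(congr1 e); rewrite !eE => /(bij_inj (tau_rat_bij G ratS)).
    exact: cf_map_inj.
  move=> d; have : range e (e d) by exists d.
  by rewrite eR => -[a _ ad]; exists a; apply: e_inj; rewrite eE.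
- move=> a b; apply: e_inj; rewrite eD !eE -!(wb_mapE W j).
  by rewrite rmorphD tau_ratD.
- move=> a b; apply: e_inj; rewrite eM !eE -!(wb_mapE W j).
  by rewrite rmorphM tau_ratM.
Qed.

(** In the square formed by [wb_map W rho], [q] and the two maps [tau], both horizontal maps are
    onto, and the bijection [tau] over [R'] matches their kernels. *)
Lemma delta_quotient_iso R : (forall R', torsion_free R' -> ring_iso (@tau R')) ->
  delta_quotient (@tau) R -> ring_iso (@tau R).
Proof.
move=> iso [R' [rho [q [tf rho_surj q_surj qker qE]]]].
have [tau_bij tauD tauM] := iso R' tf.
have tau_map a : tau (wb_map W rho a) = q (tau a) by rewrite wb_mapE qE.
split.
- apply: inj_surj_bij.
    move=> x y; have [a <-] := wb_lift x rho_surj; have [b <-] := wb_lift y rho_surj.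
    rewrite !tau_map => qab.
    have tauB : tau (a - b : wb_obj W R') = tau a - tau b.
      by apply: (addIr (tau b)); rewrite -tauD !subrK.
    have : (q @^-1` [set 0]) (tau (a - b : wb_obj W R')) by rewrite /= tauB rmorphB qab subrr.
    rewrite qker => -[c /= c0 /(bij_inj tau_bij) cE].
    apply: (@subr0_eq (wb_obj W R)); rewrite -rmorphB; apply/wb_map_eq0 => U.
    by rewrite -cE.
  move=> d; have [d' _ <-] := q_surj d I.
  have [s _ sK] := tau_bij; exists (wb_map W rho (s d')).
  by rewrite tau_map sK.
- move=> x y; have [a <-] := wb_lift x rho_surj; have [b <-] := wb_lift y rho_surj.
  by rewrite -rmorphD !tau_map tauD rmorphD.
- move=> x y; have [a <-] := wb_lift x rho_surj; have [b <-] := wb_lift y rho_surj.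
  by rewrite -rmorphM !tau_map tauM rmorphM.
Qed.

Lemma is_Delta_iso R : is_Delta (@tau) -> ring_iso (@tau R).
Proof.
move=> [Drat Dtf Dq _].
(* The ring [R'] of a presentation may or may not contain the rationals, so both cases are settled
   first. *)
have iso_tf R' : torsion_free R' -> ring_iso (@tau R').
  move=> tf; have [ratR|nratR] := pselect (contains_rat R').
    by apply: delta_rational_iso => //; exact: Drat.
  by apply: delta_torsion_free_iso => //; exact: Dtf.
have [tf|ntf] := pselect (torsion_free R); first exact: iso_tf.
by apply: delta_quotient_iso => //; exact: Dq.
Qed.

Lemma is_Delta_naturally_isomorphic : is_Delta (@tau) -> naturally_isomorphic D W.
Proof.
move=> DD; have ex A : exists eta : {rmorphism D A -> W A},
    cancel (@tau A) eta /\ cancel eta (@tau A).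
  have [[s tauK sK] tauD tauM] := is_Delta_iso A DD.
  have [|||eta etaE] := @rmorphism_of (D A) (wb_obj W A) s.
  (* Here [tau 1 = tau 1 * tau (s 1) = tau (s 1) = 1]. *)
  - apply: (can_inj tauK); rewrite sK -[RHS]mulr1 -[X in _ * X]sK.
    by rewrite -tauM mul1r sK.
  - by move=> x y; apply: (can_inj tauK); rewrite tauD !sK.
  - by move=> x y; apply: (can_inj tauK); rewrite tauM !sK.
  by exists eta; split=> x; rewrite etaE.
exists (fun A => projT1 (cid (ex A))); split=> [A|A B f x].
  by case: cid => eta [/= tauK etaK]; exists (@tau A).
case: cid => etaB [tauKB etaKB]; case: cid => etaA [tauKA etaKA] /=.
have [_ _ _ nat] := DD.
by rewrite -{1}(etaKA x) nat tauKB wb_mapE.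
Qed.

End Delta.
End Comparison.

Theorem theorem3p8 (G : profiniteGroupType) (W : witt_burnside G) :
  (exists (D : ring_functor)
          (tau : forall R : comNzRingType, class_family G R -> D R),
     is_Delta tau) /\
  (forall (D : ring_functor)
          (tau : forall R : comNzRingType, class_family G R -> D R),
     is_Delta tau -> naturally_isomorphic D W).
Proof.
split; last exact: is_Delta_naturally_isomorphic.
exists W, (fun (R : comNzRingType) (a : class_family G R) => a : wb_obj W R).
exact: wb_is_Delta.
Qed.
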